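(* A convex $n$-sided polygon $P$ of unit perimeter is a maximizer if and only if it is circumscriptible and all its interior angles are equal but possibly one, which must then be larger than the rest. Moreover, if $P$ and $Q$ are two non-congruent convex polygons of unit perimeter, possibly with a different number of sides, each of which is circumscriptible and has all its interior angles equal but possibly one, which is then larger than the rest, then $S(P)\neq S(Q)$.
   Context: Polygons are bounded planar domains bounded by a simple closed polygonal curve; a convex $m$-sided polygon has $m\geq 3$ vertices with interior angles in $(0,\pi)$. For a polygon $P$ with $m$ sides and interior angles $\theta_1,\dots,\theta_m$, set $$S(P):=\sum_{k=1}^m\frac{\pi^2-\theta_k^2}{\theta_k},$$ and let $|P|$ denote its area. A convex polygon $P$ with unit perimeter is called a maximizer if for every convex polygon $Q$ (with any number of sides) with unit perimeter and $S(Q)=S(P)$ one has $|Q|\leq |P|$. A polygon is circumscriptible if there is a circle contained in the closed polygonal region that is tangent to every side. Two polygons are congruent if one is the image of the other under an isometry of $\mathbb{R}^2$. *)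

(* Defs.v *)
From HB Require Import structures.
From mathcomp Require Import all_boot all_order all_algebra.
From mathcomp Require Import all_classical all_reals all_analysis.
Set Implicit Arguments.
Unset Strict Implicit.
Unset Printing Implicit Defensive.
Import Order.TTheory GRing.Theory Num.Theory.
Import numFieldNormedType.Exports.
Local Open Scope classical_set_scope.
Local Open Scope ring_scope.

Section Polygons.
Variable R : realType.
Implicit Types a b c p q x y : R * R.

Definition dot x y : R := x.1 * y.1 + x.2 * y.2.

Definition cross x y : R := x.1 * y.2 - x.2 * y.1.

(* The library norm of R * R is the sup norm, hence this Euclidean one. *)
Definition enorm x : R := Num.sqrt (dot x x).

Definition edist x y : R := enorm (x - y).

Definition line_point a b (t : R) : R * R :=
  (a.1 + t * (b.1 - a.1), a.2 + t * (b.2 - a.2)).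

Definition line a b : set (R * R) := range (line_point a b).

Definition segment a b : set (R * R) :=
  line_point a b @` [set t | 0 <= t <= 1].

Definition circle c (r : R) : set (R * R) := [set x | edist x c = r].

Definition tangent c (r : R) a b : Prop :=
  exists2 p, segment a b p & line a b `&` circle c r = [set p].

Section Listing.
Variable n : nat.
Implicit Type v : 'I_n -> R * R.

(* A polygon is given by its vertices listed in cyclic order; the i-th side
   joins v i to v (ordS i), where ordS is the successor modulo n.  A convex
   polygon is listed counterclockwise: it lies to the left of each of its
   sides.  Strictness for all the vertices off the side makes every interior
   angle lie in (0, pi), and the closed curve formed by the sides simple. *)
Definition convex_polygon v : Prop :=
  (3 <= n)%N /\
  forall i j : 'I_n, j != i -> j != ordS i ->
    0 < cross (v (ordS i) - v i) (v j - v i).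

(* For a convex polygon, the open region bounded by the sides. *)
Definition polygon_domain v : set (R * R) :=
  [set x | forall i : 'I_n, 0 < cross (v (ordS i) - v i) (x - v i)].

Definition area v : \bar R :=
  (lebesgue_measure \x lebesgue_measure)%E (polygon_domain v).

Definition perimeter v : R := \sum_(i < n) edist (v i) (v (ordS i)).

(* The unsigned angle between the two sides at v i; it is the interior angle
   because interior angles of convex polygons are smaller than pi. *)
Definition interior_angle v (i : 'I_n) : R :=
  let a := v (ord_pred i) - v i in
  let b := v (ordS i) - v i in
  acos (dot a b / (enorm a * enorm b)).

Definition angle_functional v : R :=
  \sum_(i < n) (pi ^+ 2 - interior_angle v i ^+ 2) / interior_angle v i.

Definition circumscriptible v : Prop :=
  exists c (r : R), [/\ 0 < r,
    circle c r `<=` closure (polygon_domain v) &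
    forall i : 'I_n, tangent c r (v i) (v (ordS i))].

Definition equal_angles_but_one_larger v : Prop :=
  exists t : R,
    (forall i, interior_angle v i = t) \/
    (exists i0, t < interior_angle v i0 /\
       forall i, i != i0 -> interior_angle v i = t).

End Listing.

Definition unit_convex_polygon n (v : 'I_n -> R * R) : Prop :=
  convex_polygon v /\ perimeter v = 1.

Definition maximizer n (P : 'I_n -> R * R) : Prop :=
  unit_convex_polygon P /\
  forall (m : nat) (Q : 'I_m -> R * R),
    unit_convex_polygon Q -> angle_functional Q = angle_functional P ->
    (area Q <= area P)%E.

Definition isometry (f : R * R -> R * R) : Prop :=
  forall x y, edist (f x) (f y) = edist x y.

Definition congruent n m (P : 'I_n -> R * R) (Q : 'I_m -> R * R) : Prop :=
  exists2 f, isometry f & f @` polygon_domain P = polygon_domain Q.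

End Polygons.

(* Main.v *)
Require Import Defs.
From HB Require Import structures.
From mathcomp Require Import all_boot all_order all_algebra.
From mathcomp Require Import all_classical all_reals all_analysis.
From mathcomp Require Import measurable_realfun ring lra.
Set Implicit Arguments.
Unset Strict Implicit.
Unset Printing Implicit Defensive.
Import Order.TTheory GRing.Theory Num.Theory.
Import numFieldNormedType.Exports.
Local Open Scope classical_set_scope.
Local Open Scope ring_scope.

(** Write x_i in (0, pi) for the exterior angles of a convex polygon, L for its
   perimeter, T for the sum of the tan (x_i / 2), and g x = x (2 pi - x) / (pi
   - x), so that S is the sum of the g x_i, while the x_i add up to 2 pi.

   Lhuilier's inequality L^2 >= 4 T * area holds, with equality exactly for
   the circumscribed polygons: subtract from P the multiple k D of the polygon
   D with the same normals circumscribed to the unit circle, k being chosen so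
   that the closed "polygon" P - k D, with sides of signed lengths, has no
   height over its first side. Summation by parts shows that its area is minus
   a weighted sum of squares, the weights being differences of cotangents of
   consecutive sides.

   It remains to minimise the sum of f x_i, f x = tan (x / 2), under fixed
   sums of the x_i and of the g x_i. By Cusa's inequality f'' / g'' is
   increasing, so that, for c < a, suitable multipliers make h = f - lam g -
   mu x increasing on [0, c], decreasing on [c, a] and increasing on [a, pi).
   To compare with k angles a and one angle b <= a, let c be the (k+1)-st
   largest x_i: the k largest ones satisfy h x_i >= h a, then h c >= h b, and
   the remaining ones satisfy h x_i >= h 0 = 0. The equality case of this
   comparison also shows that S determines a and b. *)

(** * Optimisation of the angles *)

Section Calculus.
Variable R : realType.
Implicit Types (f g : R -> R) (a b c x y : R).

(** At unit perimeter Lhuilier's inequality reads 4 T area <= 1, so for a given S the best polygons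
    are the circumscribed ones of least T, whatever their number of sides. No compactness argument
    is made: a maximizer is compared with an explicit competitor. Hence every S > 4 pi has to be
    attained by k angles a and one angle b; the values of S at the regular polygons cut (4 pi, oo)
    into intervals, each filled by the intermediate value theorem.

    In Lhuilier's inequality P - k D is in general not a polygon, so the sign of its area is not
    known beforehand; all that it keeps from P is the order of its directions. Cotangents decrease
    from one side to the next except where the direction becomes parallel to the first side, at the
    bottom and at the top. This is why k is chosen to bring the top vertex down to height 0. With
    this k, which is not taken to be L / (2 T), the defect L^2 - 4 T area is (L - 2 k T)^2 plus 2 T
    times the weighted squares. *)

Lemma is_derive_inv f x df : is_derive x 1 f df -> f x != 0 ->
  is_derive x 1 (fun y => (f y)^-1) (- (f x) ^- 2 * df).
Proof.
move=> df1 fx0; have dfv := derivableV fx0 (@ex_derive _ _ _ _ _ _ _ df1).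
by apply: DeriveDef; [exact: dfv|rewrite deriveV // derive_val].
Qed.

Lemma derive_within_continuous f df a b :
  (forall x, a <= x <= b -> is_derive x 1 f (df x)) ->
  {within `[a, b], continuous f}.
Proof.
move=> h; apply: derivable_within_continuous => x; rewrite in_itv /= => xab.
exact: (@ex_derive _ _ _ _ _ _ _ (h x xab)).
Qed.

Lemma derive_gt0_lt f df a b : a < b ->
  (forall x, a <= x <= b -> is_derive x 1 f (df x)) ->
  (forall x, a < x < b -> 0 < df x) -> f a < f b.
Proof.
move=> ab h1 h2; have [] := @MVT R f df a b ab _ (derive_within_continuous h1).
  by move=> x; rewrite in_itv /= => /andP[? ?]; apply: h1; rewrite !ltW.
move=> x; rewrite in_itv /= => /h2 dx E.
by rewrite -subr_gt0 E mulr_gt0 // subr_gt0.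
Qed.

Lemma derive_lt0_gt f df a b : a < b ->
  (forall x, a <= x <= b -> is_derive x 1 f (df x)) ->
  (forall x, a < x < b -> df x < 0) -> f b < f a.
Proof.
move=> ab h1 h2; rewrite -ltrN2.
apply: (@derive_gt0_lt (fun x => - f x) (fun x => - df x) a b ab).
- by move=> x /h1 h; exact: is_deriveN.
- by move=> x /h2; rewrite oppr_gt0.
Qed.

(** With y = pi - x this is the Cusa-Huygens inequality 3 sin y < y (2 + cos y). [D], [E] and [F]
    are successive derivatives which all vanish at pi, so the sign of the derivative of [F] passes
    up to [D]. *)
Lemma cusa_huygens x : 0 <= x < pi -> 0 < (pi - x) * (2 - cos x) - 3 * sin x.
Proof.
pose D x : R := (pi - x) * (2 - cos x) - 3 * sin x.
pose E x : R := -2 - 2 * cos x + (pi - x) * sin x.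
pose F x : R := sin x + (pi - x) * cos x.
have dF y : is_derive y 1 F (- (pi - y) * sin y).
  by rewrite /F; apply: is_derive_eq; rewrite /GRing.scale /=; ring.
have dE y : is_derive y 1 E (F y).
  by rewrite /E; apply: is_derive_eq; rewrite /F /GRing.scale /=; ring.
have dD y : is_derive y 1 D (E y).
  by rewrite /D; apply: is_derive_eq; rewrite /E /GRing.scale /=; ring.
have F0 y : 0 <= y < pi -> 0 < F y.
  move=> /andP[y0 yp]; have <- : F pi = 0 by rewrite /F sinpi subrr mul0r addr0.
  apply: (derive_lt0_gt yp (fun x _ => dF x)) => z /andP[z0 zp].
  rewrite mulNr oppr_lt0 mulr_gt0 ?subr_gt0 // sin_gt0_pi //.
  by rewrite zp andbT (le_lt_trans y0).
have E0 y : 0 <= y < pi -> E y < 0.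
  move=> /andP[y0 yp]; have <- : E pi = 0.
    by rewrite /E sinpi cospi; ring.
  apply: (derive_gt0_lt yp (fun x _ => dE x)) => z /andP[z0 zp].
  by apply: F0; rewrite zp andbT (le_trans y0) // ltW.
move=> /andP[x0 xp]; have : D pi = 0 by rewrite /D sinpi cospi; ring.
rewrite -/(D x) => <-.
apply: (derive_lt0_gt xp (fun x _ => dD x)) => z /andP[z0 zp].
by apply: E0; rewrite zp andbT (le_trans x0) // ltW.
Qed.

Definition angle_cost (x : R) : R := (pi ^+ 2 - (pi - x) ^+ 2) / (pi - x).
Definition tan_half (x : R) : R := tan (x / 2).

Let dcost (x : R) : R := pi ^+ 2 / (pi - x) ^+ 2 + 1.
Let d2cost (x : R) : R := 2 * pi ^+ 2 / (pi - x) ^+ 3.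
Let dtan_half (x : R) : R := (cos (x / 2)) ^- 2 / 2.
Let d2tan_half (x : R) : R := sin (x / 2) / cos (x / 2) ^+ 3 / 2.
(** The quotient of [d2tan_half] by [d2cost], multiplied by [4 * pi ^+ 2]. *)
Let rho (x : R) : R := (pi - x) ^+ 3 * sin (x / 2) / cos (x / 2) ^+ 3.

Lemma angle_cost0 : angle_cost 0 =
  0. Proof. by rewrite /angle_cost subr0 subrr mul0r. Qed.

Lemma tan_half0 : tan_half 0 = 0. Proof. by rewrite /tan_half mul0r tan0. Qed.

Lemma cos_half_gt0 x : 0 <= x < pi -> 0 < cos (x / 2).
Proof.
move=> /andP[x0 xp]; apply: cos_gt0_pihalf.
by apply/andP; split; have := @pi_gt0 R; lra.
Qed.

Lemma tan_half_gt0 x : 0 < x < pi -> 0 < tan_half x.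
Proof.
move=> /andP[x0 xp]; apply: divr_gt0.
  by apply: sin_gt0_pihalf; apply/andP; split; lra.
by apply: cos_half_gt0; rewrite xp ltW.
Qed.

Lemma derive_half x : is_derive x 1 (fun y : R => y / 2) (2^-1).
Proof. by apply: is_derive_eq; rewrite /GRing.scale /=; ring. Qed.

Let derive_sin_half x : is_derive x 1 (fun y : R =>
  sin (y / 2)) (cos (x / 2) / 2).
Proof.
by apply: (is_derive_eq (is_derive1_comp (is_derive_sin _) (derive_half x)));
  rewrite /GRing.scale /= ?/dtan_half; ring.
Qed.

Let derive_cos_half x :
  is_derive x 1 (fun y : R => cos (y / 2)) (- sin (x / 2) / 2).
Proof.
by apply: (is_derive_eq (is_derive1_comp (is_derive_cos _) (derive_half x)));
  rewrite /GRing.scale /= ?/dtan_half; ring.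
Qed.

Let derive_tan_half x : 0 <= x < pi -> is_derive x 1 tan_half (dtan_half x).
Proof.
move=> /cos_half_gt0 /lt0r_neq0 c0.
have d := @is_derive1_comp _ tan (fun y =>
  y / 2) x _ _ (is_derive_tan c0) (derive_half x).
by rewrite /tan_half; apply: (is_derive_eq d);
  rewrite /GRing.scale /= ?/dtan_half; ring.
Qed.

Let derive_dtan_half x : 0 <= x < pi -> is_derive x 1 dtan_half (d2tan_half x).
Proof.
move=> /cos_half_gt0 /lt0r_neq0 c0; rewrite /dtan_half.
have c20 : cos (x / 2) ^+ 2 != 0 by rewrite expf_neq0.
have dc0 := derive_cos_half x.
have dc : is_derive x 1 (fun y : R => cos (y / 2) ^+ 2)
    (- cos (x / 2) * sin (x / 2)).
  by apply: is_derive_eq; rewrite /GRing.scale /=; field.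
have dv := is_derive_inv dc c20.
apply: is_derive_eq; rewrite /d2tan_half /GRing.scale /=.
by field.
Qed.

Let derive_cost x : 0 <= x < pi -> is_derive x 1 angle_cost (dcost x).
Proof.
move=> /andP[x0 xp]; have c0 : pi - x != 0 by lra.
have d1 : is_derive x 1 (fun y : R => pi - y) (-1).
  by apply: is_derive_eq; ring.
have dv := is_derive_inv d1 c0.
rewrite /angle_cost; apply: is_derive_eq; rewrite /dcost /GRing.scale /=.
set t := pi - x in c0 *; by field.
Qed.

Lemma continuous_angle_cost x : 0 <= x < pi -> {for x, continuous angle_cost}.
Proof.
move=> /derive_cost dg; apply/differentiable_continuous/derivable1_diffP.
exact: (@ex_derive _ _ _ _ _ _ _ dg).
Qed.

Let derive_dcost x : 0 <= x < pi -> is_derive x 1 dcost (d2cost x).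
Proof.
move=> /andP[x0 xp]; have c0 : (pi - x) ^+ 2 != 0 by rewrite expf_neq0 //; lra.
have d1 : is_derive x 1 (fun y : R => (pi - y) ^+ 2) (- 2 * (pi - x)).
  by apply: is_derive_eq; rewrite /GRing.scale /=; ring.
have dv := is_derive_inv d1 c0.
rewrite /dcost; apply: is_derive_eq; rewrite /d2cost /GRing.scale /=.
by field; lra.
Qed.

(** The derivative of [rho] is a positive factor times the expression of [cusa_huygens], once that
    is written in terms of z / 2. *)
Let rho_lt x y : 0 <= x -> x < y -> y < pi -> rho x < rho y.
Proof.
move=> x0 xy yp; pose drho (z : R) : R := (pi -
  z) ^+ 2 / (2 * cos (z / 2) ^+ 4) *
  ((pi - z) * (2 - cos z) - 3 * sin z).
apply: (@derive_gt0_lt rho drho x y xy) => z /andP[zx zy].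
  have zb : 0 <= z < pi by apply/andP; split; lra.
  have /lt0r_neq0 c0 := cos_half_gt0 zb.
  have c30 : cos (z / 2) ^+ 3 != 0 by rewrite expf_neq0.
  have dc0 := derive_cos_half z.
  have dc : is_derive z 1 (fun y : R => cos (y / 2) ^+ 3)
      (- (3 / 2) * cos (z / 2) ^+ 2 * sin (z / 2)).
    by apply: is_derive_eq; rewrite /GRing.scale /=; field.
  have dv := is_derive_inv dc c30.
  have ds := derive_sin_half z.
  rewrite /rho; apply: is_derive_eq; rewrite /drho /GRing.scale /=.
  have -> : cos z = 2 * cos (z / 2) ^+ 2 - 1.
    by rewrite [in LHS](_ : z = (z / 2) *+ 2) ?cos_mulr2n; [ring|field].
  have -> : sin z = 2 * (cos (z / 2) * sin (z / 2)).
    by rewrite [in LHS](_ : z = (z / 2) *+ 2) ?sin_mulr2n; [ring|field].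
  have E : sin (z / 2) ^+ 2 = 1 - cos (z / 2) ^+ 2 by rewrite sin2cos2.
  set C := cos _ in c0 c30 E *; set S := sin _ in E *.
  transitivity ((pi - z) ^+ 2 / (2 * C ^+ 4) *
     ((pi - z) * (C ^+ 2 + 3 * S ^+ 2) - 6 * (C * S))); first by field.
  by rewrite E; field.
have zb : 0 <= z < pi by apply/andP; split; lra.
rewrite /drho mulr_gt0 ?cusa_huygens // divr_gt0 ?exprn_gt0 ?subr_gt0 //;
  first lra.
by rewrite mulr_gt0 // exprn_gt0 // cos_half_gt0.
Qed.

Let d2tan_halfE x : 0 <= x < pi -> d2tan_half x =
  rho x / (4 * pi ^+ 2) * d2cost x.
Proof.
move=> xb; have /lt0r_neq0 c0 := cos_half_gt0 xb; have p0 := @pi_gt0 R.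
case/andP: xb => x0 xp.
have px : pi - x != 0 by lra.
have p1 : pi != 0 :> R by rewrite lt0r_neq0.
rewrite /d2tan_half /rho /d2cost; set t := pi - x in px *; set P := pi in p1 *.
by clearbody P; field; rewrite ?c0 ?px ?p1.
Qed.

Let d2cost_gt0 x : 0 <= x < pi -> 0 < d2cost x.
Proof.
move=> /andP[_ xp].
by rewrite /d2cost divr_gt0 ?mulr_gt0 ?exprn_gt0 ?subr_gt0 ?pi_gt0.
Qed.

(* The multipliers make c and a critical points; since tan_half'' / angle_cost''
   is increasing, h' has no other zero. *)
Lemma lagrangian c a : 0 <= c -> c < a -> a < pi ->
  exists lam mu, let h x := tan_half x - lam * angle_cost x - mu * x in
  [/\ forall x, c <= x < pi -> x != a -> h a < h x,
      forall x, 0 <= x <= a -> x != c -> h x < h c &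
      forall x, 0 < x <= c -> 0 < h x].
Proof.
move=> c0 ca ap.
have ci x : c <= x <= a -> 0 <= x < pi.
  by move=> /andP[? ?]; apply/andP; split; lra.
have oi x : x \in `]c, a[%R -> 0 <= x < pi.
  by rewrite in_itv /= => /andP[? ?]; apply: ci; rewrite !ltW.
(* [lam] is the slope that gives h' equal values at c and a. By Cauchy's mean value theorem it is
   also the quotient of the second derivatives at some [xi] between them, so h'' has the sign of
   [rho x - rho xi]. *)
have [xi xiI] := @cauchy_MVT R dtan_half d2tan_half dcost d2cost c a ca
  (derive_within_continuous (fun x xi => derive_dtan_half (ci x xi)))
  (derive_within_continuous (fun x xi => derive_dcost (ci x xi)))
  (fun x xi => derive_dtan_half (oi x xi))
  (fun x xi => derive_dcost (oi x xi))
  (fun x xi => lt0r_neq0 (d2cost_gt0 (oi x xi))).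
set lam := (_ / _ in RHS) => lamE.
have gca : dcost c < dcost a.
  apply: (derive_gt0_lt ca (fun x xi => derive_dcost (ci x xi))) =>
    x /andP[x1 x2].
  by apply: d2cost_gt0; apply: ci; rewrite !ltW.
pose mu := dtan_half a - lam * dcost a.
exists lam, mu => h.
pose dh x := dtan_half x - lam * dcost x - mu.
pose d2h x := d2cost x * (rho x - rho xi) / (4 * pi ^+ 2).
have dha : dh a = 0 by rewrite /dh /mu; ring.
have dhc : dh c = 0.
  rewrite /dh /mu; have -> : dtan_half a = dtan_half c + lam * (dcost a -
    dcost c).
    by rewrite divfK ?subrK //; lra.
  ring.
have xib := oi _ xiI; move: xiI; rewrite in_itv /= => /andP[cxi xia].
have Dh x : 0 <= x < pi -> is_derive x 1 h (dh x).
  move=> xb; have d1 := derive_tan_half xb; have d2 := derive_cost xb.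
  by rewrite /h; apply: is_derive_eq; rewrite /dh /GRing.scale /=; ring.
have Ddh x : 0 <= x < pi -> is_derive x 1 dh (d2h x).
  move=> xb; have d1 := derive_dtan_half xb; have d2 := derive_dcost xb.
  rewrite /dh; apply: is_derive_eq; rewrite /d2h -lamE /GRing.scale /=.
  rewrite (d2tan_halfE xb) (d2tan_halfE xib) mulfK ?lt0r_neq0 ?d2cost_gt0 //.
  have p1 : pi != 0 :> R by rewrite lt0r_neq0 // pi_gt0.
  by set P := pi in p1 *; clearbody P; field; rewrite ?p1.
have p0 : 0 < 4 * pi ^+ 2 :> R by rewrite mulr_gt0 // exprn_gt0 // pi_gt0.
have dh_dec x y : 0 <= x -> x < y -> y <= xi -> dh y < dh x.
  move=> x0 xy yxi; apply: (derive_lt0_gt xy (df := d2h)) => z /andP[z1 z2].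
    by apply: Ddh; apply/andP; split; lra.
  have zb : 0 <= z < pi by apply/andP; split; lra.
  rewrite /d2h pmulr_llt0 ?invr_gt0 // pmulr_rlt0 ?d2cost_gt0 // subr_lt0.
  by apply: rho_lt; lra.
have dh_inc x y : xi <= x -> x < y -> y < pi -> dh x < dh y.
  move=> x0 xy yxi; apply: (derive_gt0_lt xy (df := d2h)) => z /andP[z1 z2].
    by apply: Ddh; apply/andP; split; lra.
  have zb : 0 <= z < pi by apply/andP; split; lra.
  rewrite /d2h pmulr_lgt0 ?invr_gt0 // pmulr_rgt0 ?d2cost_gt0 // subr_gt0.
  by apply: rho_lt; lra.
have h_inc0 x y : 0 <= x -> x < y -> y <= c -> h x < h y.
  move=> x0 xy yc; apply: (derive_gt0_lt xy (df := dh)) => z /andP[z1 z2].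
    by apply: Dh; apply/andP; split; lra.
  by rewrite -dhc dh_dec //; lra.
have h_dec x y : c <= x -> x < y -> y <= a -> h y < h x.
  move=> x0 xy yc; apply: (derive_lt0_gt xy (df := dh)) => z /andP[z1 z2].
    by apply: Dh; apply/andP; split; lra.
  case: (leP z xi) => zxi; first by rewrite -dhc dh_dec //; lra.
  by rewrite -dha dh_inc //; lra.
have h_inc1 x y : a <= x -> x < y -> y < pi -> h x < h y.
  move=> x0 xy yc; apply: (derive_gt0_lt xy (df := dh)) => z /andP[z1 z2].
    by apply: Dh; apply/andP; split; lra.
  by rewrite -dha dh_inc //; lra.
have h0 : h 0 = 0 by rewrite /h angle_cost0 tan_half0; ring.
split=> x /andP[x1 x2].
- rewrite neq_lt => /orP[xa|xa]; first by apply: h_dec => //; lra.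
  by apply: h_inc1 => //; lra.
- rewrite neq_lt => /orP[xa|xa]; first by apply: h_inc0 => //; lra.
  by apply: h_dec => //; lra.
- by rewrite -h0 h_inc0.
Qed.

End Calculus.

(** * Comparison of angle sequences, and existence of the extremal ones *)

Section Optimization.
Variable R : realType.
Implicit Types (a b c x y : R) (s t : seq R).

Lemma sum_nseq (F : R -> R) y n : \sum_(x <- nseq n y) F x = F y *+ n.
Proof. by elim: n => [|n IH]; rewrite ?big_nil //= big_cons IH mulrS. Qed.

Lemma sum_constant_seq (F : R -> R) y t : t = nseq (size t) y ->
  \sum_(x <- t) F x = F y *+ size t.
Proof. by move=> ->; rewrite sum_nseq size_nseq. Qed.

(** A termwise lower bound that keeps track of its equality case. *)
Lemma nseq_or_lt_sum (F : R -> R) y t :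
  (forall x, x \in t -> x = y \/ F y < F x) ->
  t = nseq (size t) y \/ F y *+ size t < \sum_(x <- t) F x.
Proof.
elim: t => [|x t IH] H; first by left.
have /IH {}IH : forall z, z \in t -> z = y \/ F y < F z.
  by move=> z zt; apply: H; rewrite inE zt orbT.
rewrite /= big_cons mulrS.
case: (H x (mem_head _ _)) IH => [->|xy] [E|E]; [left|right|right|right].
- by rewrite {1}E.
- by rewrite ltrD2l.
- by rewrite (sum_constant_seq _ E) ltrD2r.
- by rewrite ltrD.
Qed.

Lemma nil_or_sum_gt0 (F : R -> R) t : (forall x, x \in t -> 0 < F x) ->
  t = [::] \/ 0 < \sum_(x <- t) F x.
Proof.
case: t => [|x t] H; [by left|right].
rewrite big_cons ltr_wpDr ?H ?mem_head // big_seq sumr_ge0 // => z zt.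
by rewrite ltW // H // inE zt orbT.
Qed.

(** Both competitors satisfy the same two constraints, so the multiplier terms cancel. *)
Lemma lt_sum_lagrange (f g : R -> R) s k a b lam mu
    (h := fun x => f x - lam * g x - mu * x) :
  \sum_(x <- s) x = a *+ k + b ->
  \sum_(x <- s) g x = g a *+ k + g b ->
  h a *+ k + h b < \sum_(x <- s) h x ->
  f a *+ k + f b < \sum_(x <- s) f x.
Proof.
move=> sum_s g_s.
rewrite !big_split /= !sumrN -!mulr_sumr sum_s g_s /h -(mulr_natr _ k)
  -(mulr_natr (f a) k) -(mulr_natr (g a)) -(mulr_natr a).
set F := \sum_(_ <- _) _; rewrite -subr_gt0 => H; rewrite -subr_gt0.
apply: (lt_le_trans H); rewrite le_eqVlt; apply/orP; left; apply/eqP; ring.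
Qed.

Lemma balanced_angles_minimize s k a b : (forall x, x \in s -> 0 < x < pi) ->
  0 < b <= a -> a < pi ->
  \sum_(x <- s) x = a *+ k + b ->
  \sum_(x <- s) angle_cost x = angle_cost a *+ k + angle_cost b ->
  perm_eq s (b :: nseq k a) \/
  tan_half a *+ k + tan_half b < \sum_(x <- s) tan_half x.
Proof.
move=> s_pi /andP[b0 ba] ap sum_s cost_s.
have a0 : 0 < a by apply: lt_le_trans ba.
have lagr lam mu := @lt_sum_lagrange (@tan_half R) (@angle_cost R) s k a b lam
  mu sum_s cost_s.
pose s' := sort >=%R s.
have ss' : perm_eq s s' by rewrite perm_sym perm_sort.
have s'_pi x : x \in s' -> 0 < x <
  pi by rewrite (perm_mem (permEl (perm_sort _ _))); apply: s_pi.
(* With at most k entries there is no (k+1)-st largest one and 0 takes its place: then h a is the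
   minimum of h and is negative, so having fewer than k + 1 terms can only increase the sum. *)
have [sk|ks] := leqP (size s') k.
  right; have [lam [mu [h1 h2 h3]]] := @lagrangian R 0 a (lexx _) a0 ap.
  pose h x := tan_half x - lam * angle_cost x - mu * x.
  apply: (lagr lam mu); change (h a *+ k + h b < \sum_(x <- s) h x).
  have {}h1 : forall x, 0 <= x < pi -> x != a -> h a < h x := h1.
  have {}h2 : forall x, 0 <= x <= a -> x != 0 -> h x < h 0 := h2.
  have h0 : h 0 = 0 by rewrite /h angle_cost0 tan_half0; lra.
  have ha : h a < 0.
    by rewrite -h0 h2 ?gt_eqF // lexx ltW.
  have hb : h b < 0 by rewrite -h0 h2 ?gt_eqF // ba ltW.
  have le_sum : h a *+ size s' <= \sum_(x <- s) h x.
    rewrite (perm_big _ ss') /=.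
    have [|E|/ltW //] := @nseq_or_lt_sum h a s'.
      move=> x /s'_pi /andP[x0 xp].
      have [->|xa] := eqVneq x a; [by left|right; apply: h1 => //].
      by rewrite xp ltW.
    by rewrite (sum_constant_seq _ E).
  have : h a *+ k <= h a *+ size s' by rewrite ler_wnMn2l // ltW.
  lra.
pose c := nth 0 s' k.
pose t := take k s'; pose r := drop k.+1 s'.
have s'E : s' = t ++ c :: r by rewrite -drop_nth // cat_take_drop.
have size_t : size t = k by rewrite size_take ks.
have : sorted >=%R s' by apply: sort_sorted => x y; rewrite /= orbC le_total.
rewrite s'E sorted_pairwise; last by move=> x y z /= xy yz;
  apply: le_trans yz xy.
rewrite pairwise_cat /= => /and4P[/allrelP tc _ /allP rc _].
have t_ge x : x \in t -> c <= x by move=> xt; apply: (tc x c) => //;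
  rewrite mem_head.
have t_pi x : x \in t -> 0 < x < pi.
  by move=> xt; apply: s'_pi; rewrite s'E mem_cat xt.
have r_le x : x \in r -> x <= c by move=> /rc.
have r_pi x : x \in r -> 0 < x < pi.
  by move=> xt; apply: s'_pi; rewrite s'E mem_cat inE xt !orbT.
have /andP[c0 cp] : 0 < c < pi by apply: s'_pi;
  rewrite s'E mem_cat mem_head orbT.
have sumE (F : R -> R) : \sum_(x <- s) F x =
    \sum_(x <- t) F x + (F c + \sum_(x <- r) F x).
  by rewrite (perm_big _ ss') /= s'E big_cat big_cons.
have permE : t = nseq (size t) a -> c = b -> r = [::] ->
  perm_eq s (b :: nseq k a).
  move=> tE cb r0; rewrite (perm_trans ss') // s'E tE cb r0 size_t.
  by rewrite perm_catC.
(* If c >= a, then k entries are at least a and another one is at least b: the constraint on the sum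
   alone forces equality. *)
have [ca|ac] := ltP c a; last first.
  have r_gt0 x : x \in r -> 0 < id x by move=> /r_pi /andP[].
  left; have := sumE id; rewrite sum_s.
  have [|tE|tE] := @nseq_or_lt_sum id a t.
  - by move=> x /t_ge xc; have [->|xa] := eqVneq x a; [by left|right];
    rewrite lt_neqAle eq_sym xa /=; lra.
  - have [r0|] := nil_or_sum_gt0 r_gt0;
    rewrite (sum_constant_seq _ tE) size_t /=.
      by rewrite r0 big_nil => E; apply: permE => //; lra.
    lra.
  rewrite size_t /= in tE.
  by have [->|] := nil_or_sum_gt0 r_gt0; rewrite ?big_nil /=; lra.
have [lam [mu [h1 h2 h3]]] := @lagrangian R c a (ltW c0) ca ap.
pose h x := tan_half x - lam * angle_cost x - mu * x.
have {}h1 : forall x, c <= x < pi -> x != a -> h a < h x := h1.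
have {}h2 : forall x, 0 <= x <= a -> x != c -> h x < h c := h2.
have {}h3 : forall x, 0 < x <= c -> 0 < h x := h3.
have {}lagr : h a *+ k + h b < \sum_(x <- s) h x -> _ := lagr lam mu.
have hc : c = b \/ h b < h c.
  have [->|cb] := eqVneq c b; [by left|right].
  by apply: h2; [rewrite ba ltW | rewrite eq_sym].
have [|tE|tE] := @nseq_or_lt_sum h a t.
  move=> x xt; have [->|xa] := eqVneq x a; [by left|right].
  by apply: h1 => //; rewrite t_ge //; case/andP: (t_pi _ xt).
- have [|r0|r0] := @nil_or_sum_gt0 h r.
    by move=> x xr; apply: h3; rewrite r_le //; case/andP: (r_pi _ xr) => ->.
  + case: hc => [cb|bc]; first by left; apply: permE.
    right; apply: lagr; rewrite sumE (sum_constant_seq _ tE) size_t.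
    by rewrite r0 big_nil; lra.
  + right; apply: lagr; rewrite sumE (sum_constant_seq _ tE) size_t.
    by case: hc => [->|bc]; lra.
- right; apply: lagr; rewrite sumE.
  rewrite size_t in tE.
  have [|r0|r0] := @nil_or_sum_gt0 h r.
    by move=> x xr; apply: h3; rewrite r_le //; case/andP: (r_pi _ xr) => ->.
  + by rewrite r0 big_nil; case: hc => [->|bc]; lra.
  + by case: hc => [->|bc]; lra.
Qed.

(** The graph lies above its tangent at 0. Summed over the exterior angles, this gives S > 4 pi for
    every convex polygon. *)
Lemma angle_cost_gt x : 0 < x < pi -> 2 * x < angle_cost x.
Proof.
move=> /andP[x0 xp]; rewrite /angle_cost ltr_pdivlMr ?subr_gt0 //.
by rewrite -subr_gt0 (_ : _ - _ = x ^+ 2) ?exprn_gt0 //; set p := pi; ring.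
Qed.

(** The values of S at the regular polygons decrease to 4 pi as n grows; they are the breakpoints of
    [balanced_angles_exist]. *)
Lemma angle_cost_regular n : (2 < n)%N ->
  angle_cost (2 * pi / n%:R) *+ n = 4 * pi + 4 * pi / (n%:R - 2) :> R.
Proof.
move=> n2; rewrite /angle_cost -(mulr_natr (_ / (pi - _)) n);
  have p0 : pi != 0 :> R by rewrite lt0r_neq0 ?pi_gt0.
have : (2 : R) < n%:R by rewrite ltr_nat.
move: n%:R (pi : R) p0 => N p p0 N2.
have N2' : N - 2 != 0 by rewrite subr_eq0 gt_eqF.
field; rewrite N2' (_ : p * N - 2 * p = p * (N - 2)); last ring.
by rewrite mulf_neq0 // andbT gt_eqF //; lra.
Qed.

(** Intermediate value theorem in a, with b = 2 pi - k a; the lower end, where a = b, is the regular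
    polygon with k + 1 sides. *)
Lemma balanced_angles_between S k hi : (1 < k)%N -> hi *+ k <= 2 * pi -> hi <
  pi ->
  2 * pi / k.+1%:R <= hi ->
  angle_cost (2 * pi / k.+1%:R) *+ k.+1 <= S < angle_cost hi *+ k +
    angle_cost (2 * pi - hi *+ k) ->
  exists a b, [/\ 0 < b <= a, a < pi, a *+ k + b = 2 * pi &
    angle_cost a *+ k + angle_cost b = S].
Proof.
move=> k1 hik hip lohi /andP[S1 S2]; set lo := 2 * pi / k.+1%:R in lohi S1.
pose V a := angle_cost a *+ k + angle_cost (2 * pi - a *+ k).
have loE : lo *+ k + lo = 2 * pi.
  by rewrite -mulrSr -(mulr_natr lo) divfK // pnatr_eq0.
have bnd x : lo <= x <= hi -> 0 <= 2 * pi - x *+ k <= x.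
  move=> /andP[x1 x2].
  have : lo *+ k <= x *+ k <= hi *+ k by rewrite !lerMn2r x1 x2 !orbT.
  by move=> /andP[y1 y2]; apply/andP; split; lra.
have lo0 : 0 < lo by rewrite divr_gt0 // mulr_gt0 // pi_gt0.
have cV : {within `[lo, hi], continuous V}.
  apply: continuous_in_subspaceT => x; rewrite inE /= in_itv /= => xb.
  have /andP[b1 b2] := bnd _ xb; case/andP: xb => x1 x2.
  have cx : {for x, continuous (fun y : R => y *+ k)}.
    by apply: cvgMn; apply: cvg_id.
  apply: cvgD.
    by apply: cvgMn; apply: continuous_angle_cost; apply/andP; split; lra.
  apply: (@continuous_comp _ _ _ (fun y => 2 * pi - y *+ k) (@angle_cost R)).
    by apply: cvgB; [exact: cvg_cst|exact: cx].
  by apply: continuous_angle_cost; apply/andP; split; lra.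
have V1 : V lo <= S <= V hi.
  by rewrite (ltW S2) andbT /V -loE addrAC subrr add0r -mulrSr.
have V2 : Num.min (V lo) (V hi) <= S <= Num.max (V lo) (V hi).
  by case/andP: V1 => V1 V2; rewrite ge_min V1 /= le_max V2 orbT.
have [a] := IVT lohi cV V2; rewrite in_itv /= => aI aS.
have /andP[b1 b2] := bnd _ aI; case/andP: aI => a1 a2.
exists a, (2 * pi - a *+ k); split => //; last by rewrite addrC subrK.
  (* The strict bound on S excludes a = hi, the only place where b could vanish. *)
  rewrite b2 andbT subr_gt0; apply: lt_le_trans hik.
  rewrite ltrMn2r (ltn_trans _ k1) //= lt_neqAle a2 andbT.
  by apply: contraTneq S2 => <-; rewrite -aS ltxx.
lra.
Qed.

Lemma balanced_angles_exist S : 4 * pi < S ->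
  exists k a b, [/\ (1 < k)%N, 0 < b <= a, a < pi, a *+ k + b = 2 * pi &
    angle_cost a *+ k + angle_cost b = S].
Proof.
move=> S4; have p0 := @pi_gt0 R.
(* [P k] says that the regular polygon with k + 1 sides has functional at most S; the least such k
   selects the interval that contains S. *)
pose P k := (1 < k)%N && (4 * pi + 4 * pi / (k%:R - 1) <= S).
have exP : exists k, P k.
  pose X := 4 * pi / (S - 4 * pi).
  have X0 : 0 < X by rewrite divr_gt0 ?mulr_gt0 ?subr_gt0.
  exists (Num.bound X).+2; rewrite /P /=.
  rewrite -lerBrDl ler_pdivrMr ?subr_gt0 ?ltr1n // -ler_pdivrMl ?subr_gt0 //.
  rewrite [X in X <= _]mulrC -/X.
  apply: ltW; apply: (lt_le_trans (archi_boundP (ltW X0))).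
  by rewrite lerBrDr natr1 ler_nat.
case: (ex_minnP exP) => k /andP[k1 kS] kmin.
have lok : 2 * pi / k.+1%:R <= 2 * pi / k%:R :> R.
  rewrite ler_pM2l ?mulr_gt0 // lef_pV2 ?qualifE /= ?ltr0n ?ler_nat //.
  exact: ltn_trans k1.
have S1 : angle_cost (2 * pi / k.+1%:R) *+ k.+1 <= S.
  rewrite angle_cost_regular // (_ : k.+1%:R - 2 = k%:R - 1) //.
  by rewrite -natr1; ring.
have [k2|k2] := leqP k 2.
  have {k1 k2 kmin kS} k2 : k = 2%N by apply/eqP; rewrite eqn_leq k2.
  (* No regular 2-gon bounds this interval from above, but the cost is unbounded near pi: this d
     makes [angle_cost (pi - d)] equal to S - d, so two such angles already cost more than S. *)
  subst k; pose d := pi ^+ 2 / S.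
  have S0 : 0 < S by lra.
  have d0 : 0 < d by rewrite divr_gt0 ?exprn_gt0.
  have dp : d < pi / 4.
    by rewrite /d ltr_pdivrMr // expr2 -mulrA ltr_pM2l //; lra.
  have dS : S * d = pi ^+ 2 by rewrite mulrC divfK // gt_eqF.
  clearbody d.
  have [|||||a [b H]] := @balanced_angles_between S 2 (pi - d).
  - by [].
  - by rewrite mulr2n; lra.
  - by lra.
  - lra.
  - rewrite S1 /=.
    have d2 : d ^+ 2 <= (pi / 4) ^+ 2 by apply: lerXn2r;
      rewrite ?nnegrE ltW // divr_gt0.
    have g1 : 15 / 16 * S <= angle_cost (pi - d).
      rewrite /angle_cost subKr ler_pdivlMr // -(mulrA _ S d) dS.
      by move: d2; move: (pi : R) => p; rewrite !expr2 => d2; lra.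
    have -> : 2 * pi - (pi - d) *+ 2 = 2 * d by set p := pi; ring.
    have : 2 * (2 * d) < angle_cost (2 * d) by apply: angle_cost_gt;
      apply/andP; split; lra.
    by rewrite mulr2n; lra.
  - by case: H => *; exists 2%N, a, b.
have k0 : k%:R != 0 :> R by rewrite pnatr_eq0 -lt0n (ltn_trans _ k1).
(* At the upper end b = 0 and what remains is the regular polygon with k sides, whose functional
   exceeds S by the minimality of k. *)
have [||||a [b H]] := @balanced_angles_between S k (2 * pi / k%:R) k1.
- by rewrite -(mulr_natr (_ / _) k) divfK.
- by rewrite ltr_pdivrMr ?ltr0n ?(ltn_trans _ k1) // mulrC ltr_pM2l // ltr_nat.
- exact: lok.
- rewrite S1 angle_cost_regular // -(mulr_natr (_ / _) k) divfK //.
  rewrite subrr angle_cost0 addr0 ltNge; apply/negP => h.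
  have /kmin : P k.-1.
    rewrite /P -ltnS (ltn_predK k1) k2 /= (_ : k.-1%:R - 1 = k%:R - 2) //.
    by rewrite -[in RHS](ltn_predK k1) -natr1; ring.
  by rewrite -ltnS (ltn_predK k1) ltnn.
- by case: H => *; exists k, a, b.
Qed.

End Optimization.

(** * Convex polygons and Lhuilier's inequality *)

Section Directions.
Variable R : realType.
Implicit Types (a b c x y : R) (p q u w : R * R).

Lemma dot_ge0 p : 0 <= dot p p.
Proof. by rewrite /dot -!expr2 addr_ge0 // sqr_ge0. Qed.

Lemma sqr_enorm p : enorm p ^+ 2 = dot p p.
Proof. by rewrite sqr_sqrtr // dot_ge0. Qed.

Lemma enorm_gt0 p : p != 0 -> 0 < enorm p.
Proof.
move=> p0; rewrite sqrtr_gt0 lt_neqAle dot_ge0 andbT eq_sym.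
apply: contraNneq p0; case: p => a b; rewrite /dot /= -!expr2 => /eqP.
rewrite paddr_eq0 ?sqr_ge0 // !sqrf_eq0 => /andP[/eqP -> /eqP ->].
by apply/eqP.
Qed.

(* Unqualified, edist is the extended distance of mathcomp-analysis. *)
Lemma edistC p q : Defs.edist p q = Defs.edist q p.
Proof. by rewrite /Defs.edist /enorm /dot /=; congr Num.sqrt; ring. Qed.

Lemma lagrange_identity p q : dot p q ^+ 2 + cross p q ^+ 2 = dot p p * dot q q.
Proof. by rewrite /dot /cross; ring. Qed.

Section Angle.
Variables (u w : R * R) (x : R).
Hypotheses (u1 : dot u u = 1) (w1 : dot w w = 1) (uw : 0 < cross u w).

Lemma cross_sqr : cross u w ^+ 2 = 1 - dot u w ^+ 2.
Proof. by rewrite -(mulr1 1) -{1}u1 -w1 -lagrange_identity; ring. Qed.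

Lemma dot_lt1 : -1 < dot u w < 1.
Proof.
have : 0 < cross u w ^+ 2 by rewrite exprn_gt0.
by rewrite cross_sqr subr_gt0 -real_normK ?num_real // expr_lt1 // ltr_norml.
Qed.

Lemma dot_itv : -1 <= dot u w <= 1.
Proof. by have /andP[/ltW -> /ltW] := dot_lt1. Qed.

Lemma acos_dot : [/\ 0 < acos (dot u w) < pi, cos (acos (dot u w)) = dot u w &
  sin (acos (dot u w)) = cross u w].
Proof.
have [d1 d2] := andP dot_lt1; split.
- by rewrite acos_gt0 ?acos_ltpi // ?d1 ?d2 ?andbT ltW.
- by rewrite acosK // in_itv /= dot_itv.
- by rewrite sin_acos ?dot_itv // -cross_sqr sqrtr_sqr gtr0_norm.
Qed.

End Angle.

Lemma tan_half_trig x : 0 < x < pi ->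
  tan_half x * (1 + cos x) = sin x /\ tan_half x * sin x = 1 - cos x.
Proof.
move=> /andP[x0 xp]; have c0 : cos (x / 2) != 0.
  by rewrite lt0r_neq0 // cos_half_gt0 // xp ltW.
have E : x = (x / 2) *+ 2 by field.
have -> : cos x = 2 * cos (x / 2) ^+ 2 - 1.
  by rewrite {1}E cos_mulr2n mulr_natl.
have -> : sin x = 2 * (cos (x / 2) * sin (x / 2)).
  by rewrite {1}E sin_mulr2n mulr_natl.
rewrite /tan_half /tan; have := cos2Dsin2 (x / 2).
move: (cos _) (sin _) c0 => C S C0 CS; split; first by field.
have -> : 1 - (2 * C ^+ 2 - 1) = 2 * S ^+ 2.
  have -> : S ^+ 2 = 1 - C ^+ 2 by rewrite -CS; ring.
  ring.
by field.
Qed.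

(** Removes the ambiguity modulo 2 pi when a turn is computed as a difference of arguments. *)
Lemma gt0_sin_itv y : - pi <= y < 2 * pi -> 0 < sin y -> 0 < y < pi.
Proof.
move=> /andP[y1 y2] s0; have p0 := @pi_gt0 R; apply/andP; split.
  rewrite ltNge; apply: contraL s0 => y0.
  by rewrite -leNgt -oppr_ge0 -sinN sin_ge0_pi //; apply/andP; split; lra.
rewrite ltNge; apply: contraL s0 => yp.
rewrite -leNgt -oppr_ge0 -[y](subrK pi) sinDpi opprK sin_ge0_pi //.
by apply/andP; split; lra.
Qed.

End Directions.

(** * The cyclic successor of indices *)

Section OrdCyc.
Variable n : nat.
Implicit Types i j : 'I_n.

Lemma val_ordS i : ordS i = (if i.+1 == n then 0 else i.+1)%N :> nat.
Proof.
rewrite /=; case: eqP => [->|/eqP ne]; first by rewrite modnn.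
by rewrite modn_small // ltn_neqAle ne /=.
Qed.

Lemma ordS_neq i : (1 < n)%N -> ordS i != i.
Proof.
move=> n1; apply/eqP => /(congr1 (@nat_of_ord n)); rewrite val_ordS.
by case: eqP => [E i0|_ /eqP]; [rewrite -E -i0 in n1 | rewrite gtn_eqF].
Qed.

Lemma ordSS_neq i : (2 < n)%N -> ordS (ordS i) != i.
Proof.
move=> n2; apply/eqP => /(congr1 (@nat_of_ord n)); rewrite !val_ordS.
case: (i.+1 =P n) => [E|_].
  by case: eqP => [E' _|_ i1]; [rewrite -E' in n2 | rewrite -E -i1 in n2].
by case: eqP => [E i0|_ /eqP]; [rewrite -E -i0 in n2 | rewrite gtn_eqF].
Qed.

Lemma sum_ordS (V : zmodType) (F : 'I_n -> V) : \sum_i F (ordS i) = \sum_i F i.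
Proof. by rewrite [RHS](reindex_inj (@ordS_inj n)). Qed.

End OrdCyc.

(** Induction around the cycle: climb from i to the last index, wrap around to 0, and climb
    again. *)
Lemma ordS_closed n (P : 'I_n -> Prop) i :
  P i -> (forall j, P j -> P (ordS j)) -> forall j, P j.
Proof.
case: n P i => [|n] P i Pi PS j; first by case: i Pi.
have up : forall k (i : 'I_n.+1), P i -> forall j : 'I_n.+1, (j : nat) = (i +
  k)%N -> P j.
  elim=> [|k IH] {Pi}i Pi {}j jE; first by rewrite (_ : j = i) //;
    apply: val_inj; rewrite /= jE addn0.
  apply: (IH (ordS i)); first exact: PS.
  rewrite val_ordS; case: eqP => [E|_]; last by rewrite jE addSnnS.
  by have := ltn_ord j; rewrite jE addnS -addSn E ltnNge leq_addr.
have Pmax : P ord_max by apply: (up (n - i)%N i) => //=;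
  rewrite subnKC // -ltnS.
apply: (up (j : nat) ord0) => //=.
by rewrite (_ : ord0 = ordS ord_max); [exact: PS|apply: val_inj;
  rewrite /= modnn].
Qed.

(** * Unit directions of the sides and exterior angles *)

Section PolygonDirections.
Variables (R : realType) (n : nat) (v : 'I_n -> R * R).
Implicit Types i j : 'I_n.

Definition side_length i : R := Defs.edist (v i) (v (ordS i)).

Definition direction i : R * R :=
  (((v (ordS i)).1 - (v i).1) / side_length i,
   ((v (ordS i)).2 - (v i).2) / side_length i).

Definition exterior_angle i : R := pi - interior_angle v i.

Definition vertex_tan i : R := tan_half (exterior_angle i).

Definition shoelace : R := (\sum_i cross (v i) (v (ordS i))) / 2.

Hypothesis cv : convex_polygon v.

Let n2 : (2 < n)%N. Proof. by case: cv. Qed.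

Let n1 : (1 < n)%N. Proof. exact: ltnW. Qed.

Lemma cross_side_ge0 i j : 0 <= cross (v (ordS i) - v i) (v j - v i).
Proof.
have [->|ji] := eqVneq j i; first by rewrite /cross /=; lra.
have [->|jS] := eqVneq j (ordS i); first by rewrite /cross /=; lra.
by case: cv => _ /(_ i j ji jS) /ltW.
Qed.

Lemma side_length_gt0 i : 0 < side_length i.
Proof.
rewrite /side_length edistC; apply: enorm_gt0; rewrite subr_eq0.
apply/eqP => E; case: cv => _ /(_ i (ordS (ordS i))).
by rewrite ordSS_neq // ordS_neq // E /cross /= !subrr !mul0r subrr ltxx =>
  /(_ isT isT).
Qed.

Lemma direction1 i : (v (ordS i)).1 = (v i).1 + side_length i * (direction i).1.
Proof. by rewrite mulrC divfK ?gt_eqF ?side_length_gt0 // addrC subrK. Qed.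

Lemma direction2 i : (v (ordS i)).2 = (v i).2 + side_length i * (direction i).2.
Proof. by rewrite mulrC divfK ?gt_eqF ?side_length_gt0 // addrC subrK. Qed.

Lemma dot_direction i : dot (direction i) (direction i) = 1.
Proof.
have l0 : side_length i != 0 by rewrite gt_eqF ?side_length_gt0.
have : side_length i ^+ 2 = dot (v (ordS i) - v i) (v (ordS i) - v i).
  by rewrite /side_length edistC [LHS]sqr_enorm.
rewrite /dot /direction /=; move: (side_length i) l0 => l l0 E.
transitivity (l ^+ 2 / l ^+ 2); last by rewrite divff // expf_neq0.
by rewrite {1}E; field.
Qed.

Local Opaque direction.

Lemma cross_direction i (w : R * R) :
  cross (v (ordS i) - v i) w = side_length i * cross (direction i) w.
Proof. by rewrite /cross /= direction1 direction2; ring. Qed.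

Lemma cross_direction_gt0 i j : j != i -> j != ordS i ->
  0 < cross (direction i) (v j - v i).
Proof.
by case: cv => _ H ji jS; have := H i j ji jS;
  rewrite cross_direction pmulr_rgt0 ?side_length_gt0.
Qed.

Lemma cross_direction_ge0 i j : 0 <= cross (direction i) (v j - v i).
Proof.
by have := cross_side_ge0 i j;
  rewrite cross_direction pmulr_rge0 ?side_length_gt0.
Qed.

Lemma cross_turn_gt0 i : 0 < cross (direction i) (direction (ordS i)).
Proof.
have := @cross_direction_gt0 i (ordS (ordS i)) (ordSS_neq _ n2) (ordS_neq _ n1).
rewrite (_ : cross _ _ = side_length (ordS i) * cross (direction i) (direction
  (ordS i))).
  by rewrite pmulr_rgt0 ?side_length_gt0.
by rewrite /cross /= !(direction1 (ordS i)) !(direction2 (ordS i)) (direction1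
  i) (direction2 i); ring.
Qed.

Lemma cross_pred_gt0 i : 0 < cross (direction (ord_pred i)) (direction i).
Proof. by have := cross_turn_gt0 (ord_pred i); rewrite ord_predK. Qed.

Lemma exterior_angleE i :
  exterior_angle i = acos (dot (direction (ord_pred i)) (direction i)).
Proof.
rewrite /exterior_angle /interior_angle.
set D := dot (direction _) _.
rewrite (_ : _ / _ = - D).
  by rewrite acosN ?subKr //;
    apply: dot_itv (dot_direction _) (dot_direction _) (cross_pred_gt0 i).
have lS := side_length_gt0 (ord_pred i); have l0 := side_length_gt0 i.
have -> : enorm (v (ord_pred i) - v i) = side_length (ord_pred i).
  by rewrite /side_length ord_predK.
have -> : enorm (v (ordS i) - v i) = side_length i.
  by rewrite /side_length edistC.
have [E1 E2] := (direction1 (ord_pred i), direction2 (ord_pred i)).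
rewrite ord_predK in E1 E2.
rewrite /D /dot /= direction1 direction2 E1 E2.
move: (lt0r_neq0 lS) (lt0r_neq0 l0);
  move: (side_length _) (side_length _) => l m m0 l1.
by field; rewrite m0 l1.
Qed.

Lemma exterior_angle_trig i :
  [/\ 0 < exterior_angle i < pi,
      cos (exterior_angle i) = dot (direction (ord_pred i)) (direction i) &
      sin (exterior_angle i) = cross (direction (ord_pred i)) (direction i)].
Proof.
by rewrite exterior_angleE; apply: acos_dot;
  rewrite ?dot_direction ?cross_pred_gt0.
Qed.

Lemma exterior_angle_itv i : 0 < exterior_angle i < pi.
Proof. by case: (exterior_angle_trig i). Qed.

Lemma vertex_tan_gt0 i : 0 < vertex_tan i.
Proof. exact/tan_half_gt0/exterior_angle_itv. Qed.

Lemma vertex_tan_trig i :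
  vertex_tan i * (1 + dot (direction (ord_pred i)) (direction i)) =
    cross (direction (ord_pred i)) (direction i) /\
  vertex_tan i * cross (direction (ord_pred i)) (direction i) =
    1 - dot (direction (ord_pred i)) (direction i).
Proof.
by case: (exterior_angle_trig i) => /tan_half_trig H <- <-.
Qed.

(* The turn at a vertex rotates the outer normal (u.2, - u.1). *)
Lemma normal_turn i (p := direction (ord_pred i)) (u := direction i) :
  u.2 - p.2 = vertex_tan i * (p.1 + u.1) /\
  - u.1 + p.1 = vertex_tan i * (p.2 + u.2).
Proof.
have [] := vertex_tan_trig i; have := dot_direction (ord_pred i).
have := dot_direction i; have := dot_lt1 (dot_direction _) (dot_direction _)
  (cross_pred_gt0 i).
rewrite /dot /cross -/p -/u => /andP[d1 _] u1 p1 h1 h2.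
have d0 : 1 + (p.1 * u.1 + p.2 * u.2) != 0 by lra.
split; apply: (mulfI d0).
  rewrite [RHS]mulrA [X in _ = X * _]mulrC h1; apply/eqP; rewrite -subr_eq0;
    apply/eqP.
  transitivity (u.2 * (1 - (p.1 * p.1 + p.2 * p.2)) -
                p.2 * (1 - (u.1 * u.1 + u.2 * u.2))); first ring.
  by rewrite u1 p1; ring.
rewrite [RHS]mulrA [X in _ = X * _]mulrC h1; apply/eqP; rewrite -subr_eq0;
  apply/eqP.
transitivity (p.1 * (1 - (u.1 * u.1 + u.2 * u.2)) -
              u.1 * (1 - (p.1 * p.1 + p.2 * p.2))); first ring.
by rewrite u1 p1; ring.
Qed.

End PolygonDirections.

(** * Heights over the first side, the total turn, and Lhuilier's inequality *)

Section OneTurn.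
Variables (R : realType) (m : nat) (v : 'I_m.+3 -> R * R).
Implicit Types i j : 'I_m.+3.
Hypothesis cv : convex_polygon v.

Local Opaque direction.

Let u := direction v.
Let l := side_length v.
Let u0 := u ord0.
Let height i := cross u0 (v i - v ord0).
Let s i := cross u0 (u i).
Let c i := dot u0 (u i).

Lemma vertex_heightS i : height (ordS i) = height i + l i * s i.
Proof.
rewrite /height /s /cross /= (direction1 cv i) (direction2 cv i).
by rewrite -/u -/l; ring.
Qed.

Lemma vertex_height_gt0 i : i != ord0 -> i != ordS ord0 -> 0 < height i.
Proof. exact: cross_direction_gt0. Qed.

Lemma vertex_height0 : height ord0 = 0.
Proof. by rewrite /height /cross /=; ring. Qed.

Lemma sin_side0 : s ord0 = 0.
Proof. by rewrite /s /cross; ring. Qed.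

Lemma first_side_frame i j : dot (u i) (u j) = c i * c j + s i * s j /\
  cross (u i) (u j) = c i * s j - s i * c j.
Proof.
have := dot_direction cv ord0; rewrite -/u -/u0 /dot => u01; split.
  transitivity ((u0.1 * u0.1 + u0.2 * u0.2) * dot (u i) (u j)).
    by rewrite u01 mul1r.
  by rewrite /c /s /dot /cross; ring.
transitivity ((u0.1 * u0.1 + u0.2 * u0.2) * cross (u i) (u j)).
  by rewrite u01 mul1r.
by rewrite /c /s /dot /cross; ring.
Qed.

Lemma sin_cos_side i : c i ^+ 2 + s i ^+ 2 = 1.
Proof. by rewrite !expr2 -(first_side_frame i i).1 (dot_direction cv). Qed.

(** Otherwise the vertex [ordS i] would be a local minimum of the height, hence a global one by
    convexity, although it is strictly higher than [v ord0]. *)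
Lemma sin_side_descent i : i != ord0 -> ordS i != ord0 -> s i <= 0 ->
  s (ordS i) < 0.
Proof.
move=> i0 Si0 si; rewrite ltNge; apply/negP => sSi; pose j := ordS i.
have hj : 0 < height j.
  by apply: vertex_height_gt0 => //; rewrite (inj_eq (@ordS_inj _)).
have C0 := cross_turn_gt0 cv i; rewrite -/u -/j in C0.
have a1 : 0 <= cross (u i) (v ord0 - v j).
  have := cross_direction_ge0 cv i ord0; rewrite -/u.
  rewrite (_ : cross (u i) (v ord0 - v j) = cross (u i) (v ord0 - v i)) //.
  by rewrite /cross /= (direction1 cv i) (direction2 cv i) -/u; ring.
have a2 : 0 <= cross (u j) (v ord0 - v j) := cross_direction_ge0 cv j ord0.
(* The three-term Plücker relation for [u0], [u i], [u j] and [v ord0 - v j]; its left side is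
   negative and its right side is not. *)
have : - height j * cross (u i) (u j) =
    - s i * cross (u j) (v ord0 - v j) + s j * cross (u i) (v ord0 - v j).
  by rewrite /height /s /cross /=; ring.
have : - height j * cross (u i) (u j) < 0 by rewrite pmulr_llt0 // oppr_lt0.
have : 0 <= - s i * cross (u j) (v ord0 - v j) by rewrite mulr_ge0 // oppr_ge0.
have : 0 <= s j * cross (u i) (v ord0 - v j) by rewrite mulr_ge0.
lra.
Qed.

Lemma sin_side_pred0_lt0 : s (ord_pred ord0) < 0.
Proof.
have := vertex_heightS (ord_pred ord0);
  rewrite ord_predK vertex_height0 => /esym /eqP.
rewrite addrC addr_eq0 => /eqP E.
have : 0 < height (ord_pred ord0).
  apply: vertex_height_gt0;
    rewrite -(inj_eq (@ordS_inj _)) ord_predK eq_sym ?ordS_neq //.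
by rewrite -oppr_lt0 -E pmulr_rlt0 // (side_length_gt0 cv).
Qed.

(* The argument in [0, 2 pi) of the i-th side, relative to the first side. *)
Definition lift_angle i : R :=
  if 0 <= s i then acos (c i) else 2 * pi - acos (c i).

Lemma cos_side_itv i : -1 <= c i <= 1.
Proof.
have := sin_cos_side i; have := sqr_ge0 (s i) => h1 h2.
by rewrite -ler_norml -(expr_le1 (n := 2)) // real_normK ?num_real //; lra.
Qed.

Lemma sin_acos_cos i : sin (acos (c i)) = `|s i|.
Proof.
by rewrite sin_acos ?cos_side_itv // -(sin_cos_side i) addrC addKr sqrtr_sqr.
Qed.

Lemma lift_angleP i :
  [/\ cos (lift_angle i) = c i, sin (lift_angle i) = s i &
      if 0 <= s i then 0 <= lift_angle i <= pi
      else pi <= lift_angle i < 2 * pi].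
Proof.
have a0 := acos_ge0 (cos_side_itv i); have ap := acos_lepi (cos_side_itv i).
rewrite /lift_angle; case: ifPn => si.
  split; first by rewrite acosK // in_itv /= cos_side_itv.
    by rewrite sin_acos_cos ger0_norm.
  by rewrite a0 ap.
rewrite -ltNge in si.
have E : 2 * pi - acos (c i) = - acos (c i) + pi *+ 2.
  by rewrite addrC mulr_natl.
split.
- by rewrite E cosD2pi cosN acosK // in_itv /= cos_side_itv.
- by rewrite E sinD2pi sinN sin_acos_cos ltr0_norm // opprK.
- apply/andP; split; first by rewrite mulr2n mulrDl mul1r; lra.
  rewrite ltrBlDr ltrDl acos_gt0 // lt_neqAle.
  have /andP[-> ->] := cos_side_itv i; rewrite !andbT.
  apply: contraTneq si => c1; have /eqP : s i ^+ 2 = 0.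
    by have := sin_cos_side i; rewrite c1; lra.
  by rewrite sqrf_eq0 => /eqP ->; rewrite ltxx.
Qed.

Lemma sin_side_pred_lt0 i : i != ord0 -> s (ord_pred i) < 0 -> s i < 0.
Proof.
move=> i0 sp; have := @sin_side_descent (ord_pred i); rewrite ord_predK.
apply => //; last exact: ltW.
by apply: contraTneq sp => ->; rewrite sin_side0 ltxx.
Qed.

(** Both sides have the same sine and cosine, so they agree modulo 2 pi, and it remains to bound the
    right side. A descending side is never followed by one with [0 <= s i], except when the first
    side comes round again; there the term 2 pi closes the turn. *)
Lemma exterior_angle_lift i : exterior_angle v i =
  lift_angle i - lift_angle (ord_pred i) + (if i == ord0 then 2 * pi else 0).
Proof.
have [/andP[x0 xp] cx sx] := exterior_angle_trig cv i.
rewrite -/u in cx sx; set y := RHS.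
have [cE sE] := first_side_frame (ord_pred i) i.
have [c1 s1 b1] := lift_angleP i; have [c2 s2 b2] := lift_angleP (ord_pred i).
have yE : y = lift_angle i - lift_angle (ord_pred i) +
  (if i == ord0 then pi *+ 2 else 0).
  by rewrite /y; case: ifP; rewrite // mulr_natl.
have cy : cos y = cos (exterior_angle v i).
  rewrite cx cE yE; have -> : forall z : R, cos (z +
    (if i == ord0 then pi *+ 2 else 0)) = cos z.
    by move=> z; case: ifP => _; [exact: cosD2pi|rewrite addr0].
  by rewrite cosB c1 c2 s1 s2 mulrC [X in _ + X]mulrC.
have sy : sin y = sin (exterior_angle v i).
  rewrite sx sE yE; have -> : forall z : R, sin (z +
    (if i == ord0 then pi *+ 2 else 0)) = sin z.
    by move=> z; case: ifP => _; [exact: sinD2pi|rewrite addr0].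
  by rewrite sinB c1 c2 s1 s2; ring.
have sx0 : 0 < sin (exterior_angle v i) by rewrite sin_gt0_pi // x0.
suff yb : - pi <= y < 2 * pi.
  have /andP[y0 yp] : 0 < y < pi by apply: gt0_sin_itv; rewrite ?sy.
  by apply: cos_inj; rewrite ?cy // in_itv /= !ltW.
have p0 := @pi_gt0 R.
rewrite /y; case: eqP => [i0|/eqP i0].
  move: b1 b2; rewrite i0 sin_side0 lexx [0 <=
    s (ord_pred _)]leNgt sin_side_pred0_lt0 /=.
  have -> : lift_angle ord0 = 0.
    rewrite /lift_angle sin_side0 lexx.
    by rewrite [c ord0](dot_direction cv) acos1.
  by move=> _ /andP[b1 b2]; apply/andP; split; lra.
rewrite addr0; case: (leP 0 (s i)) b1 => [si /andP[b1 b1']|si /andP[b1 b1']].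
  case: (leP 0 (s (ord_pred i))) b2 => [sp /andP[b2 b2']|sp _].
    apply/andP; split; lra.
  by have := sin_side_pred_lt0 i0 sp; rewrite ltNge si.
by case: (leP 0 (s (ord_pred i))) b2 => [sp /andP[b2 b2']|sp /andP[b2 b2']];
  apply/andP; split; lra.
Qed.

Lemma sum_exterior_angle : \sum_i exterior_angle v i = 2 * pi.
Proof.
rewrite (eq_bigr _ (fun i _ => exterior_angle_lift i)) big_split /= sumrB.
rewrite -[X in X - _]sum_ordS -[X in _ - X]sum_ordS.
rewrite [X in _ - X](eq_bigr (fun i => lift_angle i)); last by move=> i _;
  rewrite ordSK.
by rewrite sum_ordS subrr add0r -big_mkcond big_pred1_eq.
Qed.

(** [t] is the first side after [ord0] that does not rise, so [v t] is a highest vertex. Apart from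
    the first side, only [t] can be horizontal. *)
Lemma top_side : exists t : 'I_m.+3, [/\ t != ord0, s t <= 0,
  forall i, i != ord0 -> (i < t)%N -> 0 < s i &
  forall i, (t < i)%N -> s i < 0].
Proof.
pose P k := [&& (0 < k)%N, (k < m.+3)%N & s (inord k) <= 0].
have exP : exists k, P k.
  exists (ord_pred (@ord0 m.+2)); rewrite /P ltn_ord inord_val.
  rewrite (ltW sin_side_pred0_lt0) !andbT lt0n.
  have : ord_pred (@ord0 m.+2) != ord0.
    by rewrite -(inj_eq (@ordS_inj _)) ord_predK eq_sym ordS_neq.
  by rewrite -val_eqE.
case: (ex_minnP exP) => k /and3P[k0 km sk] kmin.
have kE : (@inord m.+2 k : nat) = k by rewrite inordK.
exists (inord k); split => //.
- by rewrite -val_eqE /= kE -lt0n.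
- move=> i i0; rewrite kE => ik; rewrite ltNge; apply: contraL ik => si.
  rewrite -leqNgt; apply: kmin; rewrite /P ltn_ord inord_val si andbT.
  by rewrite lt0n -[0%N]/(val (@ord0 m.+2)) val_eqE i0.
- move=> i; rewrite kE.
  have H : forall (j : nat) i, (i : nat) = j -> (k < j)%N -> s i < 0;
    last exact: H.
  move=> {i} j; elim: j => [|j IH] i iE; first by rewrite ltn0.
  rewrite ltnS => kj.
  have jm : (j < m.+3)%N by rewrite (ltn_trans _ (ltn_ord i)) // iE.
  have ij : i = ordS (Ordinal jm).
    by apply: val_inj; rewrite /= modn_small ?iE // -iE.
  rewrite ij; apply: sin_side_descent; rewrite -?ij.
  + by rewrite -val_eqE /= -lt0n (leq_trans k0).
  + by rewrite -val_eqE /= iE.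
  + move: kj; rewrite leq_eqVlt => /orP[/eqP kj|kj].
      by rewrite (_ : Ordinal jm = inord k) //; apply: val_inj;
        rewrite /= kE kj.
    by rewrite ltW // IH.
Qed.

(** If [t] had the direction of the first side, the turn before it would start from a descending
    side, against the choice of [t]. *)
Lemma top_side_cos_lt1 t : t != ord0 -> s t <= 0 ->
  (forall i, i != ord0 -> (i < t)%N -> 0 < s i) -> c t < 1.
Proof.
move=> t0 st below; rewrite lt_neqAle; have /andP[_ ->] := cos_side_itv t.
rewrite andbT; apply/eqP => c1.
have s0 : s t = 0.
  by apply/eqP; rewrite -sqrf_eq0; apply/eqP; have := sin_cos_side t;
    rewrite c1; lra.
have := cross_pred_gt0 cv t;
  rewrite [cross _ _](first_side_frame (ord_pred t) t).2 c1 s0.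
rewrite mulr0 mulr1 sub0r oppr_gt0 => sp.
have p0 : ord_pred t != ord0.
  by apply: contraTneq sp => ->; rewrite sin_side0 ltxx.
have : (ord_pred t < t)%N.
  have := val_ordS (ord_pred t); rewrite ord_predK; case: ifP => _ tE.
    by move: t0; rewrite -val_eqE /= tE.
  by rewrite tE.
by move=> /(below _ p0); rewrite ltNge (ltW sp).
Qed.

Let tau := vertex_tan v.
(* The vertices of the polygon with the same normals as v that is circumscribed
   to the unit circle; its sides have lengths tau i + tau (ordS i). *)
Let d i : R * R := ((u i).2 - tau i * (u i).1, - (u i).1 - tau i * (u i).2).

Lemma tangent_vertexS i : d (ordS i) =
  ((u i).2 + tau (ordS i) * (u i).1, - (u i).1 + tau (ordS i) * (u i).2).
Proof.
have [] := normal_turn cv (ordS i); rewrite ordSK -/u -/tau => h1 h2.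
by congr pair; lra.
Qed.

Section Residue.
Variable k : R.

(** The signed length of the i-th side of P - k D, whose vertices are the [p i]; [X] and [Y] are
    coordinates along and across the first side, with origin [p ord0]. *)
Let res i := l i - k * (tau i + tau (ordS i)).
Let p i : R * R := ((v i).1 - k * (d i).1, (v i).2 - k * (d i).2).
Let X i := dot u0 (p i - p ord0).
Let Y i := cross u0 (p i - p ord0).

Lemma residueS i : p (ordS i) =
  ((p i).1 + res i * (u i).1, (p i).2 + res i * (u i).2).
Proof.
rewrite /p tangent_vertexS /= (direction1 cv i) (direction2 cv i) -/u /res -/l.
by congr pair; ring.
Qed.

Lemma residue_heightS i : Y (ordS i) = Y i + res i * s i.
Proof. by rewrite /Y residueS /s /cross /=; ring. Qed.

Lemma residue_abscissaS i : X (ordS i) = X i + res i * c i.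
Proof. by rewrite /X residueS /c /dot /=; ring. Qed.

(* Only the cyclic sum of the identity below matters, where W cancels. *)
Let W i := X i * Y i + cross (p ord0) (p i) + k * cross (p i) (d i).

(** Expansion of the area form at v = p + k d. Every side of the polygon d is at distance 1 from the
    origin, so the mixed terms reduce to lengths of sides of p, and the terms in d alone to lengths
    of its own sides. The terms in p alone become trapezoids over the first side. *)
Lemma cross_vertices i : cross (v i) (v (ordS i)) =
  - (res i * c i) * (Y i + Y (ordS i)) + 2 * k * res i +
  k ^+ 2 * (tau i + tau (ordS i)) + (W (ordS i) - W i).
Proof.
have u1 := dot_direction cv i; rewrite -/u in u1.
have u01 := dot_direction cv ord0; rewrite -/u -/u0 in u01.
have E1 : cross (v i) (v (ordS i)) = cross (p i) (p (ordS i)) +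
    k * (2 * res i + (cross (p (ordS i)) (d (ordS i)) - cross (p i) (d i))) +
    k ^+ 2 * (tau i + tau (ordS i)).
  have vE j : v j = ((p j).1 + k * (d j).1, (p j).2 + k * (d j).2).
    by rewrite /p; case: (v j) => a b /=; congr pair; ring.
  rewrite (vE i) (vE (ordS i)) residueS tangent_vertexS;
    move: (p i) (res i) (tau (ordS i)) => q r t'.
  rewrite /d; move: u1; rewrite /dot /cross /=;
    move: (u i) (tau i) => [a b] t /= ab.
  transitivity ((q.1 * (q.2 + r * b) - q.2 * (q.1 + r * a)) +
    k * (2 * r * (a * a + b * b) + ((q.1 + r * a) * (- a + t' * b) - (q.2 +
      r * b) * (b + t' * a)
      - (q.1 * (- a - t * b) - q.2 * (b - t * a)))) + k ^+ 2 * (t +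
        t') * (a * a + b * b)).
    by ring.
  by rewrite ab; ring.
have E2 : cross (p i) (p (ordS i)) = res i * (X i * s i - c i * Y i) +
    (cross (p ord0) (p (ordS i)) - cross (p ord0) (p i)).
  rewrite residueS /X /Y /s /c; move: u01.
  move: (p i) (p ord0) (u i) (res i) u0 => q q0 w r w0.
  rewrite /dot /cross /= => h.
  transitivity ((w0.1 * w0.1 + w0.2 * w0.2) * r * ((q.1 - q0.1) * w.2 - (q.2 -
    q0.2) * w.1) +
    q0.1 * (r * w.2) - q0.2 * (r * w.1)); last by ring.
  by rewrite h; ring.
rewrite E1 E2 /W; have := residue_heightS i; have := residue_abscissaS i.
move: (X _) (X _) (Y _) (Y _) => x' x y' y -> ->; ring.
Qed.

Lemma sum_cross_vertices : \sum_i cross (v i) (v (ordS i)) =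
  - (\sum_i (res i * c i) * (Y i + Y (ordS i))) + 2 * k * \sum_i res i +
  2 * k ^+ 2 * \sum_i tau i.
Proof.
have E : \sum_i (tau i + tau (ordS i)) = 2 * \sum_i tau i.
  by rewrite big_split /= (sum_ordS tau); ring.
rewrite (eq_bigr _ (fun i _ => cross_vertices i)) big_split.
rewrite [X in _ + X = _](_ : _ = 0) /=; last first.
  by rewrite sumrB (sum_ordS W) subrr.
have E2 : \sum_i - (res i * c i) * (Y i + Y (ordS i)) =
    - \sum_i res i * c i * (Y i + Y (ordS i)).
  by rewrite -sumrN; apply: eq_bigr => i _; rewrite mulNr.
by rewrite addr0 big_split big_split /= -!mulr_sumr E E2; congr (_ + _); ring.
Qed.

Section Top.
Variable t : 'I_m.+3.
Hypotheses (t0 : t != ord0) (st : s t <= 0)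
  (below : forall i, i != ord0 -> (i < t)%N -> 0 < s i)
  (above : forall i, (t < i)%N -> s i < 0) (Yt : Y t = 0).

Lemma residue_height0 : Y ord0 = 0.
Proof. by rewrite /Y /cross /=; ring. Qed.

Lemma sin_side_eq0 i : s i = 0 -> i = ord0 \/ i = t.
Proof.
move=> si; have [->|i0] := eqVneq i ord0; [by left|right].
have [/(below i0)|/above|] := ltngtP i t; rewrite ?si ?ltxx //.
exact: val_inj.
Qed.

Lemma Y_sin_side i : s i = 0 -> Y i = 0 /\ Y (ordS i) = 0.
Proof.
move=> si; have Yi : Y i = 0 by case: (sin_side_eq0 si) => ->;
  rewrite ?residue_height0.
by rewrite residue_heightS si mulr0 addr0 Yi.
Qed.

(** The sides pass from rising to descending only at the top, and back only at the first side. [Y]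
    vanishes there, also at both ends of a horizontal side. *)
Lemma Y_or_same_sign i : Y i = 0 \/ 0 < s (ord_pred i) * s i.
Proof.
have [->|i0] := eqVneq i ord0; first by left; rewrite residue_height0.
have [sp|sp] := eqVneq (s (ord_pred i)) 0.
  by left; have := (Y_sin_side sp).2; rewrite ord_predK.
have p0 : ord_pred i != ord0 by apply: contraNneq sp => ->; rewrite sin_side0.
have pi : (i : nat) = (ord_pred i).+1.
  have := val_ordS (ord_pred i); rewrite ord_predK; case: ifP => // _ iE.
  by move: i0; rewrite -val_eqE /= iE.
have [it|ti|it] := ltngtP i t; last by left; rewrite (val_inj it).
  right; rewrite mulr_gt0 // below //.
  by apply: ltn_trans it; rewrite pi.
right; have sp0 : s (ord_pred i) < 0.
  move: ti; rewrite pi ltnS leq_eqVlt => /orP[/eqP tp|/above //].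
  by rewrite lt_neqAle sp -(val_inj tp : t = ord_pred i).
by rewrite nmulr_rgt0 // above.
Qed.

(* Horizontal sides have s i = 0, hence kap i = 0, which is harmless since Y
   vanishes at both ends of such a side. *)
Let kap i := c i / s i.

(** A difference of cotangents is the sine of the turn divided by the product of the two sines. *)
Lemma cot_side_lt i : 0 < s (ord_pred i) * s i -> kap i < kap (ord_pred i).
Proof.
move=> ss; have : s (ord_pred i) * s i != 0 by rewrite gt_eqF.
rewrite mulf_eq0 negb_or => /andP[sp si]; rewrite -subr_gt0 /kap.
have := cross_pred_gt0 cv i;
  rewrite [cross _ _](first_side_frame (ord_pred i) i).2 => h.
rewrite (_ : _ - _ = (c (ord_pred i) * s i - s (ord_pred i) * c i) /
  (s (ord_pred i) * s i)); last by field; rewrite sp si.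
by rewrite divr_gt0.
Qed.

(** On a side that is not horizontal, [res i * c i] is [kap i] times the increment of [Y], so each
    trapezoid is [kap i] times a difference of squares. *)
Lemma residue_area : \sum_i (res i * c i) * (Y i + Y (ordS i)) =
  \sum_i (kap (ord_pred i) - kap i) * Y i ^+ 2.
Proof.
transitivity (\sum_i (kap i * Y (ordS i) ^+ 2 - kap i * Y i ^+ 2)).
  apply: eq_bigr => i _; have [si|si] := eqVneq (s i) 0.
    by have [-> ->] := Y_sin_side si; rewrite /kap si invr0; ring.
  by rewrite /kap (residue_heightS i); field.
have E : \sum_i kap i * Y (ordS i) ^+ 2 = \sum_i kap (ord_pred i) * Y i ^+ 2.
  by rewrite -[RHS]sum_ordS; apply: eq_bigr => i _; rewrite ordSK.
by rewrite sumrB E -sumrB; apply: eq_bigr => i _; rewrite mulrBl.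
Qed.

Let residue_term_ge0 i : 0 <= (kap (ord_pred i) - kap i) * Y i ^+ 2.
Proof.
case: (Y_or_same_sign i) => [->|/cot_side_lt h]; first by rewrite expr0n mulr0.
by rewrite mulr_ge0 ?sqr_ge0 // subr_ge0 ltW.
Qed.

Lemma residue_area_ge0 : 0 <= \sum_i (res i * c i) * (Y i + Y (ordS i)).
Proof. by rewrite residue_area sumr_ge0. Qed.

Lemma residue_area_eq0 : \sum_i (res i * c i) * (Y i + Y (ordS i)) = 0 ->
  forall i, Y i = 0.
Proof.
rewrite residue_area => /eqP; rewrite psumr_eq0 // => /allP H i.
case: (Y_or_same_sign i) => [//|/cot_side_lt h].
have := H i (mem_index_enum _); rewrite /= mulf_eq0 sqrf_eq0 subr_eq0.
by rewrite gt_eqF //= => /eqP.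
Qed.

(** A residue without height has only the sides [ord0] and [t]. The vanishing total length and the
    closing condition along the first side are two linear equations for them, of determinant c t - 1
    up to sign. *)
Lemma residue_eq0 : c t < 1 -> (forall i, Y i = 0) -> \sum_i res i = 0 ->
  forall i, res i = 0.
Proof.
move=> ct Y_eq0 sum_res.
have side i : i != ord0 -> i != t -> res i = 0.
  move=> i0 it; have /esym/eqP := residue_heightS i;
    rewrite !Y_eq0 add0r mulf_eq0.
  case/orP => /eqP // /sin_side_eq0 [] E;
    [by rewrite E eqxx in i0|by rewrite E eqxx in it].
have sum_c : \sum_i res i * c i = 0.
  rewrite (eq_bigr (fun i => X (ordS i) - X i)); last by move=> i _;
    rewrite residue_abscissaS; ring.
  by rewrite sumrB (sum_ordS X) subrr.
have c0 : c ord0 = 1 := dot_direction cv ord0.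
have res_t : res t = 0.
  have : \sum_i res i * (1 - c i) = 0.
    by under eq_bigr => i _ do rewrite mulrBr mulr1;
      rewrite sumrB sum_c sum_res subrr.
  rewrite (bigD1 t) //= big1 => [/eqP|i it].
    by rewrite addr0 mulf_eq0 [1 - _ == 0]subr_eq0 (gt_eqF ct) orbF => /eqP.
  have [->|i0] := eqVneq i ord0; first by rewrite c0 subrr mulr0.
  by rewrite (side i i0 it) mul0r.
have res0 : res ord0 = 0.
  rewrite (bigD1 ord0) //= big1 ?addr0 // in sum_res => i i0.
  by have [->//|it] := eqVneq i t; apply: side.
move=> i; have [->//|i0] := eqVneq i ord0.
by have [->//|it] := eqVneq i t; apply: side.
Qed.

End Top.
End Residue.

Theorem lhuilier : 4 * (\sum_i tau i) * shoelace v <= (\sum_i l i) ^+ 2 /\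
  (4 * (\sum_i tau i) * shoelace v = (\sum_i l i) ^+ 2 ->
   exists k, forall i, l i = k * (tau i + tau (ordS i))).
Proof.
have [t [t0 st below above]] := top_side.
have ct := top_side_cos_lt1 t0 st below.
have g0 : 0 < 1 - c t - tau t * s t.
  have : tau t * s t <= 0 by rewrite mulr_ge0_le0 // ltW // (vertex_tan_gt0 cv).
  lra.
(* The denominator is the height of [d t] over the first side of the circumscribed polygon, so this
   k annihilates the height of the residue at [t]. *)
pose k := height t / (1 - c t - tau t * s t).
(* The sum of [residue_area], with the local definitions of its section unfolded. *)
pose Q := \sum_i (l i - k * (tau i + tau (ordS i))) * c i *
  (cross u0 (((v i).1 - k * (d i).1, (v i).2 - k * (d i).2) -
             ((v ord0).1 - k * (d ord0).1, (v ord0).2 - k * (d ord0).2)) +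
   cross u0 (((v (ordS i)).1 - k * (d (ordS i)).1, (v (ordS i)).2 -
     k * (d (ordS i)).2) -
             ((v ord0).1 - k * (d ord0).1, (v ord0).2 - k * (d ord0).2))).
have Yt : cross u0 (((v t).1 - k * (d t).1, (v t).2 - k * (d t).2) -
             ((v ord0).1 - k * (d ord0).1, (v ord0).2 - k * (d ord0).2)) = 0.
  have u01 := dot_direction cv ord0; rewrite -/u -/u0 in u01.
  transitivity (height t - k * (dot u0 u0 - c t - tau t * s t)).
    by rewrite /height /c /s /d -/u0 /dot /cross /=; ring.
  by rewrite u01 /k divfK ?subrr // gt_eqF.
have Q0 : 0 <= Q := residue_area_ge0 st below above Yt.
have T0 : 0 < \sum_i tau i.
  rewrite (bigD1 ord0) //= ltr_pwDl ?(vertex_tan_gt0 cv) // sumr_ge0 // => i _.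
  by rewrite ltW ?(vertex_tan_gt0 cv).
have sumE : \sum_i (l i - k * (tau i + tau (ordS i))) =
    \sum_i l i - 2 * k * \sum_i tau i.
  rewrite sumrB -mulr_sumr; congr (_ - _).
  by rewrite big_split /= (sum_ordS tau); ring.
have := sum_cross_vertices k; rewrite -/Q sumE.
rewrite -[\sum_i cross _ _](@divfK _ 2) ?pnatr_eq0 // -/(shoelace v) => AE.
set T := \sum_i tau i in T0 sumE AE *; set L := \sum_i l i in sumE AE *.
(* Completing the square in [2 * k * T] gives the inequality, and equality forces both defects to
   vanish. *)
have main : 4 * T * shoelace v = L ^+ 2 - (L - 2 * k * T) ^+ 2 - 2 * T * Q.
  transitivity (2 * T * (shoelace v * 2)); first by ring.
  by rewrite AE; ring.
have TQ : 0 <= 2 * T * Q by rewrite mulr_ge0 // mulr_ge0 // ltW.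
have D0 : 0 <= (L - 2 * k * T) ^+ 2 by rewrite sqr_ge0.
split; first by rewrite main; lra.
rewrite main => E.
have /eqP : (L - 2 * k * T) ^+ 2 = 0 by lra.
rewrite sqrf_eq0 => /eqP LE.
have /eqP : 2 * T * Q = 0 by lra.
rewrite mulf_eq0 (gt_eqF (mulr_gt0 _ T0)) //= => /eqP Q_eq0.
exists k => i; apply/eqP; rewrite -subr_eq0; apply/eqP.
apply: (residue_eq0 below above ct).
- exact: (residue_area_eq0 st below above Yt).
- by rewrite sumE LE.
Qed.

End OneTurn.

(** * The Lebesgue area of a convex polygon *)

Section Crossing.
Variables (R : realType) (n : nat) (v : 'I_n -> R * R).
Implicit Types (i j k : 'I_n) (x y : R).
Hypothesis cv : convex_polygon v.

Local Opaque direction.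

Let n2 : (2 < n)%N. Proof. by case: cv. Qed.

Definition side_line i x : R :=
  (v i).2 + (x - (v i).1) * (((v (ordS i)).2 - (v i).2) / ((v (ordS i)).1 -
    (v i).1)).

(** In counterclockwise order a side crossed rightward bounds the domain from below, one crossed
    leftward from above. *)
Definition rightward x i := (v i).1 < x < (v (ordS i)).1.
Definition leftward x i := (v (ordS i)).1 < x < (v i).1.

Let side i (p : R * R) := cross (v (ordS i) - v i) (p - v i).

Lemma side_above x y i : (v i).1 < (v (ordS i)).1 ->
  (0 < side i (x, y)) = (side_line i x < y) /\
  (0 <= side i (x, y)) = (side_line i x <= y).
Proof.
move=> h; have e0 : 0 < (v (ordS i)).1 - (v i).1 by rewrite subr_gt0.
have -> : side i (x, y) = ((v (ordS i)).1 - (v i).1) * (y - side_line i x).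
  by rewrite /side /side_line /cross /=; field; rewrite gt_eqF.
by rewrite pmulr_rgt0 // pmulr_rge0 // subr_gt0 subr_ge0.
Qed.

Lemma side_below x y i : (v (ordS i)).1 < (v i).1 ->
  (0 < side i (x, y)) = (y < side_line i x) /\
  (0 <= side i (x, y)) = (y <= side_line i x).
Proof.
move=> h; have e0 : 0 < (v i).1 - (v (ordS i)).1 by rewrite subr_gt0.
have -> : side i (x, y) = ((v i).1 - (v (ordS i)).1) * (side_line i x - y).
  by rewrite /side /side_line /cross /=; field;
    rewrite lt_eqF // -oppr_gt0 opprB.
by rewrite pmulr_rgt0 // pmulr_rge0 // subr_gt0 subr_ge0.
Qed.

Lemma side_linear i (p q : R * R) a :
  side i ((1 - a) * p.1 + a * q.1, (1 - a) * p.2 + a * q.2) =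
  (1 - a) * side i p + a * side i q.
Proof. by rewrite /side /cross /=; ring. Qed.

Lemma side_vertex_eq0 i j : side i (v j) = 0 -> j = i \/ j = ordS i.
Proof.
move=> E; have [->|ji] := eqVneq j i; first by left.
have [->|jS] := eqVneq j (ordS i); first by right.
by case: cv => _ /(_ i j ji jS); rewrite -/(side i (v j)) E ltxx.
Qed.

Lemma crossing_convex x i : rightward x i \/ leftward x i ->
  exists2 a, 0 < a < 1 &
  (x, side_line i x) = ((1 - a) * (v i).1 + a * (v (ordS i)).1,
                        (1 - a) * (v i).2 + a * (v (ordS i)).2).
Proof.
move=> H; exists ((x - (v i).1) / ((v (ordS i)).1 - (v i).1)).
  case: H => /andP[h1 h2].
    rewrite divr_gt0 ?subr_gt0 // ?(lt_trans h1) //=.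
    by rewrite ltr_pdivrMr ?mul1r ?ltrD2r // subr_gt0 (lt_trans h1).
  rewrite -mulrNN -invrN !opprB divr_gt0 ?subr_gt0 // ?(lt_trans h1) //=.
  by rewrite ltr_pdivrMr ?mul1r ?ltrD2l ?ltrN2 // subr_gt0 (lt_trans h1).
have e0 : (v (ordS i)).1 - (v i).1 != 0.
  by rewrite subr_eq0; case: H => /andP[h1 h2];
    [rewrite gt_eqF|rewrite lt_eqF]; rewrite // (lt_trans h1).
by rewrite /side_line; congr pair; field.
Qed.

Lemma crossing_side_ge0 x i j : rightward x i \/ leftward x i ->
  0 <= side j (x, side_line i x).
Proof.
move=> /crossing_convex [a /andP[a0 a1] ->]; rewrite side_linear.
by rewrite addr_ge0 // mulr_ge0 ?(cross_side_ge0 cv) ?subr_ge0 ?ltW.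
Qed.

(** The crossing point is interior to side i. If it lies on the line of side j then, both ends of
    side i being on the left of that line or on it, both lie on it. *)
Lemma crossing_side_eq0 x i j : rightward x i \/ leftward x i ->
  side j (x, side_line i x) = 0 -> i = j.
Proof.
move=> /crossing_convex [a /andP[a0 a1] ->]; rewrite side_linear => /eqP.
have h1 : 0 <= (1 - a) * side j (v i).
  by rewrite mulr_ge0 ?(cross_side_ge0 cv) // subr_ge0 ltW.
have h2 : 0 <= a * side j (v (ordS i)).
  by rewrite mulr_ge0 ?(cross_side_ge0 cv) // ltW.
rewrite paddr_eq0 // !mulf_eq0 subr_eq0 (gt_eqF a1) (gt_eqF a0) /=.
move=> /andP[/eqP/side_vertex_eq0 E1 /eqP/side_vertex_eq0 E2].
case: E1 => // E1; case: E2 => [E2|/ordS_inj //].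
by have := ordSS_neq j n2; rewrite -E1 E2 eqxx.
Qed.

(** Each crossing point lies on or above the line of the other side, so the two points coincide. *)
Lemma rightward_unique x i j : rightward x i -> rightward x j -> i = j.
Proof.
move=> ri rj; apply: (@crossing_side_eq0 x); first by left.
have lt_of k : rightward x k -> (v k).1 < (v (ordS k)).1.
  by move=> /andP[h /(lt_trans h)].
have h1 := crossing_side_ge0 j (or_introl ri).
have h2 := crossing_side_ge0 i (or_introl rj).
apply/eqP; rewrite eq_le h1 andbT leNgt (side_above _ _ (lt_of _ rj)).1 -leNgt.
by rewrite (side_above _ _ (lt_of _ ri)).2 in h2.
Qed.

Lemma leftward_unique x i j : leftward x i -> leftward x j -> i = j.
Proof.
move=> ri rj; apply: (@crossing_side_eq0 x); first by right.
have lt_of k : leftward x k -> (v (ordS k)).1 < (v k).1.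
  by move=> /andP[h /(lt_trans h)].
have h1 := crossing_side_ge0 j (or_intror ri).
have h2 := crossing_side_ge0 i (or_intror rj).
apply/eqP; rewrite eq_le h1 andbT leNgt (side_below _ _ (lt_of _ rj)).1 -leNgt.
by rewrite (side_below _ _ (lt_of _ ri)).2 in h2.
Qed.

Section Abscissa.
Variable x : R.
Hypothesis xv : forall i, (v i).1 != x.

(** If there are vertices on both sides of the vertical line, a cyclic listing must cross it in both
    directions. *)
Lemma abscissa_cases :
  [\/ exists i j, rightward x i /\ leftward x j,
      forall i, (v i).1 < x | forall i, x < (v i).1].
Proof.
have [[i xi]|] := pselect (exists i, (v i).1 < x); last first.
  move=> /forallNP H; constructor 3 => i; rewrite lt_neqAle eq_sym xv /= leNgt.
  exact/negP/H.
have [[j xj]|] := pselect (exists j, x < (v j).1); last first.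
  move=> /forallNP H; constructor 2 => k; rewrite lt_neqAle xv /= leNgt.
  exact/negP/H.
constructor 1.
have [[i0 ri]|/forallNP nr] := pselect (exists i, rightward x i); last first.
  have /(_ _ j) := @ordS_closed n (fun k => (v k).1 < x) i xi.
  rewrite ltNge (ltW xj) => H; suff : false by []; apply: H => k xk.
  by have /negP := nr k; rewrite /rightward xk /= -leNgt lt_neqAle xv.
have [[j0 rj]|/forallNP nl] := pselect (exists i, leftward x i).
  by exists i0, j0.
have /(_ _ i) := @ordS_closed n (fun k => x < (v k).1) j xj.
rewrite ltNge (ltW xi) => H; suff : false by []; apply: H => k xk.
by have /negP := nl k; rewrite /leftward xk andbT -leNgt lt_neqAle eq_sym xv.
Qed.

(** On the chord each side functional is a proper convex combination of two nonnegative values. Both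
    vanish only if i and j are the same side, which cannot go right and left at once. *)
Lemma domain_between i j y : rightward x i -> leftward x j ->
  polygon_domain v (x, y) <-> side_line i x < y < side_line j x.
Proof.
move=> ri lj; have hi : (v i).1 < (v (ordS i)).1 by case/andP: ri =>
  h /(lt_trans h).
have hj : (v (ordS j)).1 < (v j).1 by case/andP: lj => h /(lt_trans h).
split=> [D|/andP[y1 y2] k].
  by rewrite -(side_above _ _ hi).1 -(side_below _ _ hj).1 !D.
rewrite -/(side k (x, y)).
have h1 := crossing_side_ge0 k (or_introl ri).
have h2 := crossing_side_ge0 k (or_intror lj).
set a := side_line i x in y1 h1; set b := side_line j x in y2 h2.
have ab : a < b := lt_trans y1 y2.
pose t := (y - a) / (b - a).
have t0 : 0 < t by rewrite divr_gt0 // subr_gt0.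
have t1 : t < 1 by rewrite ltr_pdivrMr ?mul1r ?ltrD2r // subr_gt0.
have yE : side k (x, y) = (1 - t) * side k (x, a) + t * side k (x, b).
  rewrite -side_linear /=; congr (side k (_, _)); first ring.
  by rewrite /t; field; rewrite subr_eq0 gt_eqF.
clearbody t.
have p1 : 0 <= (1 - t) * side k (x, a) by rewrite mulr_ge0 // subr_ge0 ltW.
have p2 : 0 <= t * side k (x, b) by rewrite mulr_ge0 // ltW.
rewrite lt_neqAle yE addr_ge0 // andbT eq_sym paddr_eq0 //.
rewrite !mulf_eq0 subr_eq0 (gt_eqF t1) (gt_eqF t0) /=.
apply/negP => /andP[/eqP E1 /eqP E2].
have ik := crossing_side_eq0 (or_introl ri) E1.
have jk := crossing_side_eq0 (or_intror lj) E2.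
by move: hi hj; rewrite ik jk => /lt_trans H /H; rewrite ltxx.
Qed.

Lemma side_line_le i j : rightward x i -> leftward x j ->
  side_line i x <= side_line j x.
Proof.
move=> ri lj; have hj : (v (ordS j)).1 < (v j).1 by case/andP: lj =>
  h /(lt_trans h).
by have := crossing_side_ge0 j (or_introl ri); rewrite (side_below _ _ hj).2.
Qed.

End Abscissa.

(** Cramer's rule at the corner [v i]: it locates p horizontally from its distances to the two
    adjacent side lines. *)
Lemma corner_decomposition i (p : R * R) :
  (p.1 - (v i).1) * cross (direction v (ord_pred i)) (direction v i) =
  - (direction v (ord_pred i)).1 * cross (direction v i) (p - v i) +
  (direction v i).1 * cross (direction v (ord_pred i)) (p - v (ord_pred i)).
Proof.
have [E1 E2] := (direction1 cv (ord_pred i), direction2 cv (ord_pred i)).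
rewrite ord_predK in E1 E2.
move: E1 E2; move: (direction _ _) (direction _ _) => a b.
by rewrite /cross /= => -> ->; ring.
Qed.

(** At a leftmost vertex the incoming side does not go right and the outgoing one does not go left,
    and they are not both vertical; [corner_decomposition] then has a positive right side. A
    rightmost vertex is symmetric. *)
Lemma domain_abscissa p : polygon_domain v p ->
  exists i j, (v i).1 < p.1 < (v j).1.
Proof.
move=> D; have D' k : 0 < cross (direction v k) (p - v k).
  by have := D k; rewrite (cross_direction cv) pmulr_rgt0 ?side_length_gt0.
pose i0 : 'I_n := Ordinal (ltn_trans (isT : 0 < 2)%N n2).
have sgn k : 0 < side_length v k := side_length_gt0 cv k.
exists [arg min_(i < i0) (v i).1]%O, [arg max_(i > i0) (v i).1]%O.
case: arg_minP => // i _ imin; case: arg_maxP => // j _ jmax; apply/andP; split.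
  rewrite -subr_gt0 -(pmulr_lgt0 _ (cross_pred_gt0 cv i)) corner_decomposition.
  have h1 : (direction v (ord_pred i)).1 <= 0.
    have := imin (ord_pred i) isT; rewrite -{1}[i]ord_predK (direction1 cv).
    by rewrite gerDl pmulr_rle0.
  have h2 : 0 <= (direction v i).1.
    by have := imin (ordS i) isT; rewrite (direction1 cv) lerDl pmulr_rge0.
  have : (direction v (ord_pred i)).1 != 0 \/ (direction v i).1 != 0.
    have := cross_pred_gt0 cv i; rewrite /cross.
    have [->|] := eqVneq (direction v (ord_pred i)).1 0; last by left.
    by have [->|] := eqVneq (direction v i).1 0;
      [rewrite !(mul0r, mulr0) subrr ltxx|right].
  case=> h.
    apply: ltr_pwDl; first by rewrite mulr_gt0 // oppr_gt0 lt_neqAle h.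
    by rewrite mulr_ge0 // ltW.
  apply: ltr_wpDl; first by rewrite mulr_ge0 ?oppr_ge0 // ltW.
  by rewrite mulr_gt0 // lt_neqAle eq_sym h.
rewrite -subr_lt0 -(pmulr_llt0 _ (cross_pred_gt0 cv j)) corner_decomposition.
have h1 : 0 <= (direction v (ord_pred j)).1.
  have : (v (ord_pred j)).1 <= (v (ordS (ord_pred j))).1.
    by rewrite ord_predK; apply: jmax.
  rewrite (direction1 cv).
  by rewrite lerDl pmulr_rge0.
have h2 : (direction v j).1 <= 0.
  have : (v (ordS j)).1 <= (v j).1 by apply: jmax.
  by rewrite (direction1 cv) gerDl pmulr_rle0.
have : (direction v (ord_pred j)).1 != 0 \/ (direction v j).1 != 0.
  have := cross_pred_gt0 cv j; rewrite /cross.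
  have [->|] := eqVneq (direction v (ord_pred j)).1 0; last by left.
  by have [->|] := eqVneq (direction v j).1 0;
    [rewrite !(mul0r, mulr0) subrr ltxx|right].
move: (D' j) (D' (ord_pred j)) h1 h2; move: (cross _ _) (cross _ _) => y x.
move: (direction v (ord_pred j)).1 (direction v j).1 => a b y0 x0 a0 b0 ab0.
rewrite -oppr_gt0; have -> : - (- a * x + b * y) = a * x + - b * y by ring.
case: ab0 => h.
  apply: ltr_pwDl; first by rewrite mulr_gt0 // lt_neqAle eq_sym h.
  by rewrite mulr_ge0 ?oppr_ge0 // ltW.
apply: ltr_wpDl; first by rewrite mulr_ge0 // ltW.
by rewrite mulr_gt0 // oppr_gt0 lt_neqAle h.
Qed.

End Crossing.

(** * Integrals of affine functions over segments *)

Section AffineIntegral.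
Variable R : realType.
Let mu := @lebesgue_measure R.

Definition affine (p q s x : R) : R := p + (x - q) * s.

Lemma continuous_affine p q s : continuous (affine p q s).
Proof.
move=> x; apply: cvgD; first exact: cvg_cst.
apply: cvgM; last exact: cvg_cst.
by apply: cvgB; [exact: cvg_id|exact: cvg_cst].
Qed.

Lemma integrable_affine p q s a b :
  mu.-integrable setT (EFin \o (affine p q s \_ `[a, b])).
Proof.
rewrite -restrict_EFin; apply/(integrable_mkcond _ _).1 => //.
apply: continuous_compact_integrable; first exact: segment_compact.
exact/continuous_subspaceT/continuous_affine.
Qed.

Lemma integral_affine p q s a b : a < b ->
  (\int[mu]_x ((affine p q s \_ `[a, b]) x)%:E =
    ((p + ((a + b) / 2 - q) * s) * (b - a))%:E)%E.
Proof.
move=> ab; rewrite -(_ : \int[mu]_(x in `[a, b]) (affine p q s x)%:E =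
    \int[mu]_x ((affine p q s \_ `[a, b]) x)%:E)%E; last first.
  by rewrite integral_mkcond; apply: eq_integral => x _; rewrite !patchE;
    case: ifP.
pose F (x : R) : R := p * x + (s / 2) * (x - q) ^+ 2.
have dF (x : R) : is_derive x 1 F (affine p q s x).
  by rewrite /F; apply: is_derive_eq; rewrite /affine /GRing.scale /=; field.
have cF : continuous (F : R -> R).
  move=> x; apply/differentiable_continuous/derivable1_diffP.
  exact: (@ex_derive _ _ _ _ _ _ _ (dF x)).
rewrite (@continuous_FTC2 _ _ F) //.
- by rewrite -EFinB /F; congr (_%:E); field.
- exact/continuous_subspaceT/continuous_affine.
- split.
  + by move=> x _; exact: (@ex_derive _ _ _ _ _ _ _ (dF x)).
  + exact/cvg_at_right_filter/cF.
  + exact/cvg_at_left_filter/cF.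
- by move=> x _; rewrite derive1E; exact: (@derive_val _ _ _ _ _ _ _ (dF x)).
Qed.

End AffineIntegral.

(** * The shoelace formula by integration of vertical sections *)

Section Area.
Variables (R : realType) (n : nat) (v : 'I_n -> R * R).
Implicit Types (i j k : 'I_n) (x y : R).
Hypothesis cv : convex_polygon v.
Let mu := @lebesgue_measure R.

Lemma measurable_polygon_domain : measurable (polygon_domain v).
Proof.
rewrite (_ : polygon_domain v = \bigcap_(i in [set: 'I_n])
  [set x | 0 < cross (v (ordS i) - v i) (x - v i)]); last first.
  by apply/seteqP; split=> x /= H i; [move=> _|]; apply: H.
apply: fin_bigcap_measurable; first exact: finite_finset.
move=> i _; pose f (x : R * R) := (v (ordS i) - v i).1 * (x.2 - (v i).2) -
  (v (ordS i) - v i).2 * (x.1 - (v i).1).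
have mf : measurable_fun setT f.
  by apply: measurable_funB; apply: measurable_funM => //;
    apply: measurable_funB.
have -> : [set x | 0 < cross (v (ordS i) - v i) (x - v i)] =
  setT `&` f @^-1` `]0, +oo[.
  rewrite setTI; by apply/seteqP; split => x /=; rewrite in_itv /= andbT.
exact: mf.
Qed.

Let slope i := ((v (ordS i)).2 - (v i).2) / ((v (ordS i)).1 - (v i).1).

(* The contribution of the i-th side to the length of the vertical section. *)
Let signed_line i : R -> R :=
  if (v i).1 < (v (ordS i)).1
  then affine (- (v i).2) (v i).1 (- slope i) \_ `[(v i).1, (v (ordS i)).1]
  else if (v (ordS i)).1 < (v i).1
  then affine (v i).2 (v i).1 (slope i) \_ `[(v (ordS i)).1, (v i).1]
  else cst 0.

Lemma integrable_signed_line i : mu.-integrable setT (EFin \o signed_line i).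
Proof.
rewrite /signed_line; case: ifP => _; first exact: integrable_affine.
by case: ifP => _; [exact: integrable_affine|exact: integrable0].
Qed.

Lemma integral_signed_line i : (\int[mu]_x (signed_line i x)%:E =
  (- ((v (ordS i)).1 - (v i).1) * ((v i).2 + (v (ordS i)).2) / 2)%:E)%E.
Proof.
rewrite /signed_line; case: ltgtP => h.
- rewrite integral_affine //; congr (_%:E); rewrite /slope; field.
  by rewrite subr_eq0 gt_eqF.
- rewrite integral_affine //; congr (_%:E); rewrite /slope; field.
  by rewrite subr_eq0 lt_eqF.
- by rewrite integral0 h subrr oppr0 !mul0r.
Qed.

Lemma signed_lineE x i : (forall i, (v i).1 != x) -> signed_line i x =
  if rightward v x i then - side_line v i x
  else if leftward v x i then side_line v i x else 0.
Proof.
move=> xv; rewrite /signed_line /rightward /leftward.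
have x1 := xv i; have x2 := xv (ordS i).
have E a b : a != x -> b != x -> (x \in `[a, b]%classic) = (a < x < b).
  move=> ax bx; apply/idP/idP; rewrite inE /= in_itv /=.
    by rewrite !lt_neqAle ax [x == b]eq_sym bx.
  by move=> /andP[/ltW -> /ltW ->].
case: ltgtP => h; rewrite ?patchE ?E //.
- case: ifP => [_|_]; first by rewrite /affine /side_line /slope; ring.
  by case: ifP => // /andP[a b]; have := lt_trans a b; rewrite ltNge (ltW h).
- have -> : ((v i).1 < x < (v (ordS i)).1) = false.
    by apply/negP => /andP[a b]; have := lt_trans (lt_trans a b) h;
      rewrite ltxx.
  by case: ifP => _.
- case: ifP => [/andP[a b]|_].
    by have := lt_trans a b; rewrite h ltxx.
  by case: ifP => // /andP[a b]; have := lt_trans a b; rewrite h ltxx.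
Qed.

Lemma section_length x : (forall i, (v i).1 != x) ->
  mu (xsection (polygon_domain v) x) = (\sum_i signed_line i x)%:E.
Proof.
move=> xv; rewrite (eq_bigr _ (fun i _ => signed_lineE i xv)).
have nocross : (forall i j, ~ (v i).1 < x < (v j).1) ->
    mu (xsection (polygon_domain v) x) = (\sum_i
      (if rightward v x i then - side_line v i x
       else if leftward v x i then side_line v i x else 0))%:E.
  move=> H; rewrite big1 => [|i _]; last first.
    by rewrite /rightward /leftward; do 2![case: ifP => [/H //|_]].
  rewrite (_ : xsection _ _ = set0);
    first exact: (measure0 (@lebesgue_measure R)).
  apply/seteqP; split => // y; rewrite /xsection /= inE.
  by move/(domain_abscissa cv) => [i [j /H]].
case: (abscissa_cases xv) => [[i [j [ri lj]]]|H|H].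
- rewrite (_ : xsection _ _ = `]side_line v i x, side_line v j x[%classic);
  last first.
    apply/seteqP; split => y; rewrite /xsection /= inE in_itv /=.
      by move/(domain_between cv y ri lj).
    by move=> h; apply/(domain_between cv y ri lj).
  have sle := side_line_le cv ri lj.
  have ij : j != i.
    apply/eqP => E; move: ri lj; rewrite E /rightward /leftward.
    by move=> /andP[a b] /andP[c d]; have := lt_trans a (lt_trans b c);
      have := lt_trans c d; rewrite ltNge => /negP h1 h2; apply: h1;
      rewrite ltW // (lt_trans a b).
  have njr : rightward v x j = false.
    by apply/negP => rj; move: ij; rewrite (rightward_unique cv ri rj) eqxx.
  rewrite (bigD1 i) //= (bigD1 j) //= big1 => [|k /andP[ki kj]]; last first.
    case: ifP => [rk|_]; first by move: ki;
      rewrite (rightward_unique cv ri rk) eqxx.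
    by case: ifP => [lk|//]; move: kj; rewrite (leftward_unique cv lj lk) eqxx.
  rewrite ri njr lj addr0 /mu lebesgue_measure_itv /= lte_fin.
  case: ltgtP sle => // [h _|-> _].
    by rewrite -EFinB addrC.
  by rewrite addNr.
- by apply: nocross => i j /andP[_]; rewrite ltNge (ltW (H j)).
- by apply: nocross => i j /andP[]; rewrite ltNge (ltW (H i)).
Qed.

Theorem area_shoelace : area v = (shoelace v)%:E.
Proof.
rewrite /area /product_measure1.
transitivity (\int[mu]_x (\sum_i signed_line i x)%:E)%E.
  apply: ae_eq_integral => //.
  - apply: measurable_fun_xsection; exact: measurable_polygon_domain.
  - under eq_fun do rewrite -sumEFin.
    apply: (measurable_int mu); apply: integrable_sum => // i _.
    exact: integrable_signed_line.
  (* The section formula may fail only at the finitely many abscissae of vertices, a null set. *)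
  - exists [set` [seq (v i).1 | i : 'I_n]]; split.
    + apply: countable_measurable; first by move=> t; apply: measurable_set1.
      exact/finite_set_countable/finite_seq.
    + apply: countable_lebesgue_measure0; exact/finite_set_countable/finite_seq.
    + move=> x /= H; apply: contrapT => nx; apply: H => _.
      apply: section_length => i; apply/eqP => E; apply: nx.
      by rewrite -E; apply/mapP; exists i; rewrite ?mem_enum.
under eq_integral do rewrite -sumEFin.
rewrite integral_sum //; last exact: integrable_signed_line.
rewrite (eq_bigr _ (fun i _ => integral_signed_line i)) sumEFin; congr (_%:E).
(* The trapezoid and shoelace terms of a side differ by the variation of x y / 2 along it, which
   telescopes. *)
rewrite /shoelace mulr_suml; apply/eqP; rewrite -subr_eq0 -sumrB; apply/eqP.
rewrite (eq_bigr (fun i => (v i).1 * (v i).2 / 2 -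
  (v (ordS i)).1 * (v (ordS i)).2 / 2)).
  by rewrite sumrB (sum_ordS (fun i => (v i).1 * (v i).2 / 2)) subrr.
by move=> i _; rewrite /cross; field.
Qed.

End Area.

(** * Circumscribed polygons *)

Lemma continuous_line (R : realType) (x d : R * R) :
  continuous (fun e : R => (x.1 - e * d.1, x.2 - e * d.2)).
Proof.
move=> e.
have c1 (a b : R) : (a - y * b) @[y --> e] --> a - e * b.
  by apply: cvgB; [exact: cvg_cst|apply: cvgM; [exact: cvg_id|exact: cvg_cst]].
exact: (cvg_pair (c1 x.1 d.1) (c1 x.2 d.2)).
Qed.

Section Inscribed.
Variables (R : realType) (n : nat) (v : 'I_n -> R * R).
Implicit Types (i j : 'I_n) (c x : R * R) (r : R).
Hypothesis cv : convex_polygon v.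

Local Opaque direction.
Let u := direction v.
Let l := side_length v.
Let tau := vertex_tan v.

(** The working form of [circumscriptible]: the signed distance from c to every side line is r. *)
Definition inscribed c r := forall i, cross (direction v i) (c - v i) = r.

Section Tangency.
Variables (c : R * R) (r : R).
Hypothesis cr : inscribed c r.

(** The centre is at distance r from both side lines at a vertex, which determines its position
    there: both tangents from the vertex have length [r * tau]. *)
Lemma tangent_length i : dot (u i) (c - v i) = r * tau i /\
  dot (u i) (c - v (ordS i)) = - (r * tau (ordS i)).
Proof.
have key j : dot (u j) (c - v j) = r * tau j /\
    dot (u (ord_pred j)) (c - v j) = - (r * tau j).
  have [_ h2] := vertex_tan_trig cv j; have C0 := cross_pred_gt0 cv j.
  have c1 := cr j; have c2 := cr (ord_pred j).
  have u1 := dot_direction cv j; have p1 := dot_direction cv (ord_pred j).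
  have [E1 E2] := (direction1 cv (ord_pred j), direction2 cv (ord_pred j)).
  rewrite ord_predK in E1 E2.
  have {}c2 : cross (u (ord_pred j)) (c - v j) = r.
    rewrite -c2 -/u; move: E1 E2; rewrite -/u.
    by rewrite /cross /= => -> ->; ring.
  move: h2 C0 c1 c2 u1 p1; rewrite -/u -/tau.
  move: (u j) (u (ord_pred j)) (tau j) (c - v j) => a b t w h C0 c1 c2 a1 b1.
  have C1 : cross b a != 0 by rewrite gt_eqF.
  split; apply: (mulIf C1).
    transitivity (cross b w * dot a a - cross a w * dot b a).
      by rewrite /dot /cross; ring.
    by rewrite a1 c1 c2 -[RHS]mulrA h; ring.
  transitivity (- (cross a w * dot b b - cross b w * dot b a)).
    by rewrite /dot /cross; ring.
  by rewrite b1 c1 c2 [RHS]mulNr -[X in _ = - X]mulrA h; ring.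
split; first by have [] := key i.
by have [_] := key (ordS i); rewrite ordSK.
Qed.

Lemma inscribed_length i : l i = r * (tau i + tau (ordS i)).
Proof.
have [h1 h2] := tangent_length i; have u1 := dot_direction cv i.
rewrite -/u in u1; rewrite mulrDr -h1 -[r * tau (ordS i)]opprK -h2.
transitivity (l i * dot (u i) (u i)); first by rewrite u1 mulr1.
by rewrite /dot /= (direction1 cv) (direction2 cv) -/u -/l; ring.
Qed.

Lemma inscribed_sum_length : \sum_i l i = 2 * r * \sum_i tau i.
Proof.
rewrite (eq_bigr _ (fun i _ => inscribed_length i)) -mulr_sumr big_split /=.
by rewrite (sum_ordS tau); ring.
Qed.

Lemma inscribed_shoelace : shoelace v = r / 2 * \sum_i l i.
Proof.
have E i : cross (v i) (v (ordS i)) =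
    r * l i + (cross c (v (ordS i)) - cross c (v i)).
  rewrite -(cr i) -/u /cross /= (direction1 cv) (direction2 cv) -/u -/l; ring.
rewrite /shoelace (eq_bigr _ (fun i _ => E i)) big_split /= sumrB.
by rewrite (sum_ordS (fun i => cross c (v i))) subrr addr0 -mulr_sumr; ring.
Qed.

Lemma polygon_domain_inscribed x :
  polygon_domain v x <-> forall i, - r < cross (direction v i) (x - c).
Proof.
have E i : cross (v (ordS i) - v i) (x - v i) =
    l i * (cross (direction v i) (x - c) + r).
  rewrite (cross_direction cv) -/l; congr (_ * _).
  transitivity (cross (direction v i) (x - c) + cross (direction v i) (c -
    v i)).
    by rewrite /cross /=; ring.
  by rewrite (cr i).
split=> H i; have := H i.
  by rewrite E pmulr_rgt0 ?side_length_gt0 // -[- r < _]subr_gt0 opprK.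
by rewrite E pmulr_rgt0 ?side_length_gt0 // -[- r < _]subr_gt0 opprK.
Qed.

Lemma inscribed_circumscriptible : 0 < r -> circumscriptible v.
Proof.
move=> r0; exists c, r; split=> // [x|i].
  rewrite /circle /= => xr B Bx.
  have dxr : dot (x - c) (x - c) =
    r ^+ 2 by rewrite -sqr_enorm -[enorm _]/(Defs.edist x c) xr.
  (* A point of the circle is a limit of points pulled towards the centre, which lie in the open
     domain. *)
  pose f (e : R) : R * R := (x.1 - e * (x.1 - c.1), x.2 - e * (x.2 - c.2)).
  have cf : {for 0, continuous f} := @continuous_line R x (x - c) 0.
  have : nbhs (f 0) B by rewrite /f !mul0r !subr0; case: (x) Bx.
  move/cf => /nbhs_ballP [e /= e0 He].
  pose d := Num.min (e / 2) (1 / 2).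
  have d0 : 0 < d by rewrite lt_min !divr_gt0.
  have de : d < e by rewrite gt_min ltr_pdivrMr // ltr_pMr // ltr1n.
  have d1 : d < 1 by rewrite gt_min; apply/orP; right; lra.
  exists (f d); split; last first.
    by apply: He; rewrite /ball /= sub0r normrN gtr0_norm.
  apply/polygon_domain_inscribed => i.
  have -> : cross (direction v i) (f d - c) = (1 -
    d) * cross (direction v i) (x - c).
    by rewrite /cross /f /=; ring.
  have : `|cross (direction v i) (x - c)| <= r.
    rewrite -ler_sqr ?nnegrE ?(ltW r0) // real_normK ?num_real // -dxr.
    have := lagrange_identity (direction v i) (x - c).
    by rewrite (dot_direction cv) mul1r => <-; rewrite lerDr sqr_ge0.
  rewrite ler_norml => /andP[h _].
  have : (1 - d) * - r <= (1 - d) * cross (direction v i) (x - c).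
    by rewrite ler_pM2l // subr_gt0.
  apply: lt_le_trans; rewrite mulrN ltrN2 mulrBl mul1r ltrBlDr ltrDl.
  by rewrite mulr_gt0.
have [h1 h2] := tangent_length i; have l0 := side_length_gt0 cv i.
have t0 j : 0 < tau j := vertex_tan_gt0 cv j.
have r1 := ltW r0; have t1 j := ltW (t0 j); have l1 := ltW l0.
pose p := ((v i).1 + r * tau i * (u i).1, (v i).2 + r * tau i * (u i).2).
have pE : p = line_point (v i) (v (ordS i)) (r * tau i / l i).
  rewrite /line_point /p (direction1 cv) (direction2 cv) -/u -/l.
  have l2 : l i != 0 by rewrite gt_eqF.
  by congr pair; field.
have u1 := dot_direction cv i; rewrite -/u in u1.
(* Pythagoras with respect to the foot of the perpendicular from c; hence the line meets the circle
   only there. *)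
have on_line (s : R) (q := line_point (v i) (v (ordS i)) s) :
    dot (q - c) (q - c) = r ^+ 2 + (s * l i - r * tau i) ^+ 2.
  have c1 := cr i; rewrite -/u in c1.
  have /= := lagrange_identity (u i) (q - c); rewrite u1 mul1r => <-.
  have -> : cross (u i) (q - c) = - r.
    rewrite -c1 /cross /q /line_point /= (direction1 cv) (direction2 cv) -/u
      -/l.
    ring.
  have -> : dot (u i) (q - c) = s * l i - r * tau i.
    rewrite -h1 -[l i]mulr1 -u1 /dot /q /line_point /= (direction1 cv)
      (direction2 cv) -/u -/l.
    ring.
  by ring.
exists p.
  exists (r * tau i / l i) => //=; apply/andP; split.
    by apply: divr_ge0; [apply: mulr_ge0; [exact: r1|exact: t1]|exact: l1].
  rewrite ler_pdivrMr // mul1r [X in _ <= X]inscribed_length mulrDr lerDl.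
  by apply: mulr_ge0; [exact: r1|exact: t1].
apply/seteqP; split=> q /=.
  move=> [[s _ <-]]; rewrite /circle /= /Defs.edist => /(congr1 (fun z =>
    z ^+ 2)).
  rewrite sqr_enorm on_line => /eqP; rewrite -subr_eq0 addrAC subrr add0r.
  rewrite sqrf_eq0 subr_eq0 => /eqP E; rewrite pE; congr line_point.
  by rewrite -E mulfK // gt_eqF.
move=> ->; rewrite pE; split; first by exists (r * tau i / l i).
rewrite /circle /= /Defs.edist /enorm on_line divfK ?gt_eqF // subrr.
by rewrite expr0n addr0 sqrtr_sqr gtr0_norm.
Qed.

End Tangency.

Lemma closed_side i : closed [set x | 0 <= cross (direction v i) (x - v i)].
Proof.
pose f (x : R * R) := (direction v i).1 * (x.2 - (v i).2) -
  (direction v i).2 * (x.1 - (v i).1).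
rewrite (_ : [set x | _] = f @^-1` [set y | 0 <= y]) //.
apply: preimage_closed; last exact: closed_ge.
move=> x _; apply: cvgB; (apply: cvgM; first exact: cvg_cst).
  by apply: cvgB; [exact: cvg_snd|exact: cvg_cst].
by apply: cvgB; [exact: cvg_fst|exact: cvg_cst].
Qed.

Lemma circumscriptible_inscribed : circumscriptible v ->
  exists c r, 0 < r /\ inscribed c r.
Proof.
move=> [c [r [r0 sub tan]]]; exists c, r; split=> // i.
have u1 := dot_direction cv i; rewrite -/u in u1.
have le : r <= cross (u i) (c - v i).
  (* The point of the circle farthest in the outer normal direction of side i; it is still in the
     closed half plane of the side. *)
  pose x := (c.1 + r * (u i).2, c.2 - r * (u i).1).
  have : closure (polygon_domain v) x.
    apply: sub; rewrite /circle /= /Defs.edist /enorm.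
    have -> : dot (x - c) (x - c) = r ^+ 2.
      transitivity (r ^+ 2 * dot (u i) (u i)); last by rewrite u1 mulr1.
      by rewrite /dot /x /=; ring.
    by rewrite sqrtr_sqr gtr0_norm.
  have : polygon_domain v `<=` [set x | 0 <= cross (direction v i) (x - v i)].
    move=> y /(_ i); rewrite (cross_direction cv) pmulr_rgt0 ?side_length_gt0
      //.
    exact: ltW.
  move=> /closureS; rewrite -((closure_id _).1 (@closed_side i)).
  move=> /[apply] /=; rewrite -/u.
  have -> : cross (u i) (x - v i) = cross (u i) (c - v i) - r * dot (u i) (u i).
    by rewrite /cross /dot /x /=; ring.
  by rewrite u1 mulr1 subr_ge0.
apply/eqP; rewrite eq_le le andbT.
have [p _ tE] := tan i; have : [set p] p by [].
rewrite -tE => -[[s _ pE] pc].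
have dp : dot (p - c) (p - c) =
  r ^+ 2 by rewrite -sqr_enorm -[enorm _]/(Defs.edist p c) pc.
have := lagrange_identity (u i) (p - c); rewrite u1 mul1r dp.
have -> : cross (u i) (p - c) = - cross (u i) (c - v i).
  by rewrite -pE /cross /line_point /= (direction1 cv) (direction2 cv) -/u;
    ring.
rewrite sqrrN => E.
have : cross (u i) (c - v i) ^+ 2 <= r ^+ 2 by rewrite -E lerDr sqr_ge0.
by rewrite ler_sqr ?nnegrE ?(ltW r0) // (le_trans (ltW r0) le).
Qed.

(** Each side proposes a centre, at distance k on its left, above the point at distance [k * tau i]
    from [v i]. The condition on lengths makes the proposals of consecutive sides agree. *)
Lemma length_inscribed k : (forall i, l i = k * (tau i + tau (ordS i))) ->
  0 < k /\ exists c, inscribed c k.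
Proof.
move=> lE; pose i0 : 'I_n := Ordinal (ltn_trans (isT : 0 < 2)%N (proj1 cv)).
have t0 j : 0 < tau j := vertex_tan_gt0 cv j.
split.
  by have := side_length_gt0 cv i0; rewrite -/l lE pmulr_lgt0 // addr_gt0.
pose c i := ((v i).1 + k * tau i * (u i).1 - k * (u i).2,
             (v i).2 + k * tau i * (u i).2 + k * (u i).1).
have cS i : c (ordS i) = c i.
  have [h1 h2] := normal_turn cv (ordS i); rewrite ordSK -/u -/tau in h1 h2.
  have h1' : (u (ordS i)).2 = (u i).2 + tau (ordS i) * ((u i).1 +
    (u (ordS i)).1) by rewrite -h1; ring.
  have h2' : (u (ordS i)).1 = (u i).1 - tau (ordS i) * ((u i).2 +
    (u (ordS i)).2) by rewrite -h2; ring.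
  rewrite /c (direction1 cv) (direction2 cv) -/u -/l lE; congr pair.
    by rewrite [X in _ - k * X]h1'; ring.
  by rewrite [X in _ + k * X]h2'; ring.
have cE i : c i = c i0.
  by apply: (@ordS_closed _ (fun i => c i = c i0) i0) => // j <-; exact: cS.
exists (c i0) => i; rewrite -(cE i) -/u.
transitivity (k * dot (u i) (u i));
  last by rewrite [dot _ _](dot_direction cv) mulr1.
by rewrite /cross /dot /c /=; ring.
Qed.

End Inscribed.

(** * The extremal polygons *)

Section Construction.
Variables (R : realType) (k : nat) (a b r : R).
Implicit Types i j : 'I_k.+1.
Hypotheses (k1 : (1 < k)%N) (ba : 0 < b <= a) (ap : a < pi)
  (kab : a *+ k + b = 2 * pi) (r0 : 0 < r).

Let b0 : 0 < b. Proof. by case/andP: ba. Qed.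
Let a0 : 0 < a. Proof. by case/andP: ba => ? /(lt_le_trans _) ->. Qed.
Let bp : b < pi. Proof. by case/andP: ba => _ /le_lt_trans ->. Qed.

Let x i : R := if i == ord0 then b else a.
Let A i : R := a *+ i.
Let t i := tan_half (x i).

Let x_itv i : 0 < x i < pi.
Proof. by rewrite /x; case: ifP => _; apply/andP. Qed.

Let t_gt0 i : 0 < t i. Proof. exact: tan_half_gt0. Qed.

(* The sides are tangent to the circle of radius r centred at the origin, at the
   points of argument A i. *)
Definition balanced_vertex i : R * R :=
  (r * (cos (A i) + t i * sin (A i)), r * (sin (A i) - t i * cos (A i))).
Let P := balanced_vertex.

(** The equality a k + b = 2 pi enters at the wrap-around, where the argument drops back to 0. *)
Lemma tangent_angleS i : cos (A (ordS i)) = cos (A i + x (ordS i)) /\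
  sin (A (ordS i)) = sin (A i + x (ordS i)).
Proof.
have := val_ordS i; rewrite eqSS; case: eqP => [ik|_] E.
  have Si : ordS i = ord0 by apply: val_inj.
  by rewrite Si /x eqxx /A /= ik kab mulr_natl cos2pi sin2pi mulr0n cos0 sin0.
by rewrite /x -val_eqE /= [(_ %% _)%N]E /A E mulrSr.
Qed.

Lemma cos_tangent_angle i : cos (A i - A (ord_pred i)) = cos (x i).
Proof.
have [c s] := tangent_angleS (ord_pred i); rewrite ord_predK in c s.
rewrite cosB c s -cosB; congr cos; ring.
Qed.

Lemma balanced_vertexS i : P (ordS i) =
  ((P i).1 - r * (t i + t (ordS i)) * sin (A i),
   (P i).2 + r * (t i + t (ordS i)) * cos (A i)).
Proof.
rewrite /P /balanced_vertex; have [-> ->] := tangent_angleS i.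
have [] := tan_half_trig (x_itv (ordS i)); rewrite -/(t (ordS i)) cosD sinD.
move: (cos (x _)) (sin (x _)) (t (ordS i)) (t i) => C S T t' h1 h2.
rewrite /=; congr pair.
  transitivity (r * (cos (A i) * (C + T * S) + sin (A i) * (T * (1 + C) - S -
    T))); first ring.
  by rewrite h1 h2; ring.
transitivity (r * (sin (A i) * (C + T * S) + cos (A i) * (S - T * (1 + C) +
  T))); first ring.
by rewrite h1 h2; ring.
Qed.

Lemma cross_balanced i j : cross (P (ordS i) - P i) (P j - P i) =
  r * (t i + t (ordS i)) * r * (1 - cos (A j - A i) - t j * sin (A j - A i)).
Proof.
rewrite balanced_vertexS /P /balanced_vertex /cross /= cosB sinB;
  have := cos2Dsin2 (A i).
move: (cos (A i)) (sin (A i)) (cos (A j)) (sin (A j)) (t i) (t j) (t i +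
  t (ordS i)).
move=> c s c' s' ti tj T E.
transitivity (r * T * r * ((c ^+ 2 + s ^+ 2) - (c' * c + s' * s) -
  tj * (s' * c - c' * s))).
  ring.
by rewrite E.
Qed.

(** The factored form reduces the convexity of [P] to the signs of two sines. *)
Lemma one_sub_cos_tan (d z : R) : cos (z / 2) != 0 -> 1 - cos d -
  tan_half z * sin d =
  2 * sin (d / 2) * sin (d / 2 - z / 2) / cos (z / 2).
Proof.
move=> c0; rewrite /tan_half /tan.
have E : d = (d / 2) *+ 2 by field.
have -> : cos d = 2 * cos (d / 2) ^+ 2 - 1 by rewrite {1}E cos_mulr2n mulr_natl.
have -> : sin d = 2 * (cos (d / 2) * sin (d / 2)) by rewrite {1}E sin_mulr2n
  mulr_natl.
rewrite sinB; have := sin2cos2 (d / 2).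
move: (cos (d / 2)) (sin (d / 2)) (cos (z / 2)) (sin (z / 2)) c0 =>
  c s c' s' c0 h.
transitivity (2 * (s ^+ 2 - s' / c' * (c * s))); first by rewrite h; field.
by field.
Qed.

Lemma balanced_convex : convex_polygon P.
Proof.
split=> // i j ji jS; rewrite cross_balanced.
have c0 : 0 < cos (x j / 2).
  by apply: cos_half_gt0; have /andP[h ->] := x_itv j; rewrite ltW.
rewrite one_sub_cos_tan ?gt_eqF // pmulr_rgt0; last first.
  by rewrite mulr_gt0 // mulr_gt0 // addr_gt0.
rewrite divr_gt0 // -mulrA mulr_gt0 //; set d := (A j - A i) / 2.
have [xj0 xjp] := andP (x_itv j).
have A_le p q : (p <= q)%N -> a *+ p <= a *+ q by move=> pq; rewrite ler_pMn2l.
have [h1 h2 h3 h4] := (And4 a0 b0 bp kab).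
have Ai : 0 <= A i by rewrite mulrn_wge0 // ltW.
have Aj : 0 <= A j by rewrite mulrn_wge0 // ltW.
have Aik : A i <= a *+ k by apply: A_le; rewrite -ltnS.
have Ajk : A j <= a *+ k by apply: A_le; rewrite -ltnS.
(* Both arguments lie in (0, pi) when i < j, and both in (-pi, 0) when j < i. The excluded case
   [j = ordS i] is the one where a sine vanishes. *)
case: (ltngtP i j) => [ij|ij|/val_inj ij]; last by rewrite ij eqxx in ji.
- have ij1 : (i.+1 < j)%N.
    rewrite ltn_neqAle ij andbT; apply: contraNneq jS => ij1.
    by apply/eqP/val_inj; rewrite /= modn_small ?ij1 // ltn_ord.
  have xj : x j = a.
    by rewrite /x -val_eqE /=; case: eqP => // j0; rewrite j0 in ij.
  have dE : A j - A i >= a *+ 2.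
    by rewrite lerBrDl -mulrnDr; apply: A_le; rewrite addnC.
  rewrite mulr2n in dE.
  by rewrite mulr_gt0 // sin_gt0_pi //; apply/andP; split; rewrite /d; lra.
- have dE : A i - A j + x j < 2 * pi.
    rewrite -kab; have [j0|j0] := eqVneq j ord0.
      rewrite /x j0 eqxx ltrD2r /A /= mulr0n subr0 ltr_pMn2l // -ltnS.
      have : (i < k.+1)%N by []; rewrite ltnS leq_eqVlt => /orP[/eqP ik|//].
      move: jS; rewrite j0 => /negP []; apply/eqP/val_inj.
      by rewrite /= ik modnn.
    rewrite /x (negPf j0).
    have : A i + a *+ 1 <= a *+ k + A j.
      rewrite -!mulrnDr; apply: A_le; rewrite addn1.
      by apply: (leq_trans (ltn_ord i));
        rewrite -[X in (X <= _)%N]addn1 leq_add2l lt0n.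
    by rewrite mulr1n; lra.
  have dN : A i - A j > 0 by rewrite subr_gt0 ltr_pMn2l.
  rewrite -mulrNN -!sinN mulr_gt0 // sin_gt0_pi //; apply/andP; split;
    rewrite /d; lra.
Qed.

Lemma balanced_length i : side_length P i = r * (t i + t (ordS i)).
Proof.
rewrite /side_length edistC /Defs.edist /enorm /dot balanced_vertexS /P
  /balanced_vertex /=.
set l := r * (t i + t (ordS i)).
have l0 : 0 <= l by rewrite ltW // mulr_gt0 // addr_gt0.
rewrite [X in Num.sqrt X](_ : _ = l ^+ 2); first by rewrite sqrtr_sqr ger0_norm.
transitivity (l ^+ 2 * (cos (A i) ^+ 2 + sin (A i) ^+ 2)); first ring.
by rewrite cos2Dsin2 mulr1.
Qed.

Lemma balanced_direction i : direction P i = (- sin (A i), cos (A i)).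
Proof.
have l0 : r * (t i + t (ordS i)) != 0 by rewrite gt_eqF // mulr_gt0 // addr_gt0.
rewrite /direction balanced_length balanced_vertexS /=; congr pair.
  by move: (r * _) l0 => l l0; field.
by move: (r * _) l0 => l l0; field.
Qed.

Lemma balanced_exterior i : exterior_angle P i = x i.
Proof.
rewrite (exterior_angleE balanced_convex) !balanced_direction /dot /=.
rewrite [X in acos X](_ : _ = cos (x i)).
  by rewrite cosK // in_itv /=; have /andP[/ltW -> /ltW ->] := x_itv i.
by rewrite -cos_tangent_angle cosB; ring.
Qed.

Lemma balanced_inscribed : inscribed P (0, 0) r.
Proof.
move=> i; rewrite balanced_direction /P /balanced_vertex /cross /=.
transitivity (r * (cos (A i) ^+ 2 + sin (A i) ^+ 2)); first by rewrite !sub0r;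
  ring.
by rewrite cos2Dsin2 mulr1.
Qed.

End Construction.

(** * Congruence of circumscribed polygons with the same cyclic sequence of angles *)

Section Congruence.
Variables (R : realType) (n : nat) (P Q : 'I_n -> R * R).
Implicit Types (i j : 'I_n) (w z : R * R).
Hypotheses (cP : convex_polygon P) (cQ : convex_polygon Q).

Local Opaque direction.

Definition cmul w z : R * R := (w.1 * z.1 - w.2 * z.2, w.1 * z.2 + w.2 * z.1).

Lemma cmulCA w z z' : cmul w (cmul z z') = cmul z (cmul w z').
Proof. by rewrite /cmul /=; congr pair; ring. Qed.

Lemma dot_cmul w z z' : dot (cmul w z) (cmul w z') = dot w w * dot z z'.
Proof. by rewrite /dot /cmul /=; ring. Qed.

Lemma cross_cmul w z z' : cross (cmul w z) (cmul w z') = dot w w * cross z z'.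
Proof. by rewrite /dot /cross /cmul /=; ring. Qed.

Lemma val_iter_ordS k i : (iter k (@ordS n) i : nat) = ((i + k) %% n)%N.
Proof.
elim: k => [|k IH]; first by rewrite addn0 modn_small.
by rewrite iterS /= IH -addn1 modnDml addn1 addnS.
Qed.

(** Aligns two listings whose exceptional vertices have different indices. *)
Lemma iter_ordS_eq k i j : (iter k (@ordS n) i == i) =
  (iter k (@ordS n) j == j).
Proof.
have E i' : (iter k (@ordS n) i' == i') = (k == 0 %[mod n])%N.
  rewrite -val_eqE /= val_iter_ordS -[X in _ == X](modn_small (ltn_ord i')).
  by rewrite -{2}[i' : nat]addn0 eqn_modDl.
by rewrite !E.
Qed.

Lemma iter_ordS_onto i0 i : exists k, i = iter k (@ordS n) i0.
Proof.
apply: (@ordS_closed n (fun i => exists k, i = iter k (@ordS n) i0) i0).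
  by exists 0%N.
by move=> j [k ->]; exists k.+1.
Qed.

Lemma direction_turn (v : 'I_n -> R * R) i : convex_polygon v ->
  direction v (ordS i) =
  cmul (cos (exterior_angle v (ordS i)), sin (exterior_angle v (ordS i)))
       (direction v i).
Proof.
move=> cv; have [_ -> ->] := exterior_angle_trig cv (ordS i); rewrite ordSK.
have := dot_direction cv i;
  move: (direction v i) (direction v (ordS i)) => u w u1.
have w1 : w = (w.1 * dot u u,
  w.2 * dot u u) by rewrite u1 !mulr1 -surjective_pairing.
by rewrite {1}w1 /cmul /dot /cross /=; congr pair; ring.
Qed.

Section Rotation.
Variables (i0 j0 : 'I_n) (c c' : R * R) (r : R).
Hypotheses (Pr : inscribed P c r) (Qr : inscribed Q c' r).
Hypothesis PQ : forall k, exterior_angle Q (iter k (@ordS n) j0) =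
  exterior_angle P (iter k (@ordS n) i0).

(* As a complex number, direction Q j0 / direction P i0. *)
Let w : R * R := (dot (direction P i0) (direction Q j0),
  cross (direction P i0) (direction Q j0)).

Let w1 : dot w w = 1.
Proof.
by rewrite /dot /w /= -!expr2 lagrange_identity !dot_direction // mulr1.
Qed.

Lemma direction_rotation k : direction Q (iter k (@ordS n) j0) =
  cmul w (direction P (iter k (@ordS n) i0)).
Proof.
elim: k => [|k IH].
  rewrite /= /w; have := dot_direction cP i0.
  move: (direction P i0) (direction Q j0) => p q p1.
  have {1}-> : q = (q.1 * dot p p,
    q.2 * dot p p) by rewrite p1 !mulr1 -surjective_pairing.
  by rewrite /cmul /dot /cross /=; congr pair; ring.
have := PQ k.+1; rewrite !iterS => E.
by rewrite !direction_turn // IH E cmulCA.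
Qed.

(** A circumscribed domain is determined by its centre, its radius and the directions of its sides,
    so the rotation by [w] that sends one centre to the other carries P onto Q. *)
Lemma inscribed_congruent : congruent P Q.
Proof.
pose f (x : R * R) := ((cmul w (x - c)).1 + c'.1, (cmul w (x - c)).2 + c'.2).
have dir x : polygon_domain P x <-> polygon_domain Q (f x).
  rewrite (polygon_domain_inscribed cP Pr) (polygon_domain_inscribed cQ Qr).
  have E k : cross (direction Q (iter k (@ordS n) j0)) (f x - c') =
      cross (direction P (iter k (@ordS n) i0)) (x - c).
    rewrite direction_rotation (_ : f x - c' = cmul w (x - c)).
      by rewrite cross_cmul w1 mul1r.
    by rewrite /f; case: (cmul w _) => ? ? /=; rewrite /= -[LHS]/(_, _);
      congr pair; rewrite addrK.
  split=> H i.
    by have [k ->] := iter_ordS_onto j0 i; rewrite E.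
  by have [k ->] := iter_ordS_onto i0 i; rewrite -E.
exists f.
  move=> x y; rewrite /Defs.edist /enorm; congr Num.sqrt.
  transitivity (dot (cmul w (x - y)) (cmul w (x - y))).
    by rewrite /dot /f /cmul /=; ring.
  by rewrite dot_cmul w1 mul1r.
apply/seteqP; split=> [_ [x Px <-]|y Qy]; first exact/dir.
(* Since [w] has modulus 1, its conjugate inverts the rotation. *)
pose x := ((cmul (w.1, - w.2) (y - c')).1 + c.1, (cmul (w.1, - w.2) (y -
  c')).2 + c.2).
have fx : f x = y.
  have -> : y = (dot w w * (y.1 - c'.1) + c'.1, dot w w * (y.2 - c'.2) + c'.2).
    by rewrite w1 !mul1r !subrK -surjective_pairing.
  by rewrite /f /x /cmul /dot /=; congr pair; ring.
by exists x => //; apply/dir; rewrite fx.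
Qed.

End Rotation.
End Congruence.

(** * Balanced polygons and the extremal problem *)

Section Balanced.
Variables (R : realType).

Lemma angle_functionalE n (v : 'I_n -> R * R) :
  angle_functional v = \sum_i angle_cost (exterior_angle v i).
Proof. by apply: eq_bigr => i _; rewrite /angle_cost /exterior_angle subKr. Qed.

(** Transfers to every n what was proved over ['I_m.+3], where a first side [ord0] is available. *)
Lemma convex_polygon_ind n (v : 'I_n -> R * R) (T : forall n, ('I_n ->
  R * R) -> Prop) :
  (forall m (v : 'I_m.+3 -> R * R), convex_polygon v -> T _ v) ->
  convex_polygon v -> T n v.
Proof.
by move=> H; move: v; case: n => [|[|[|m]]] v cv; [case: (cv)..|exact: H].
Qed.

Lemma convex_sum_exterior n (v : 'I_n -> R * R) : convex_polygon v ->
  \sum_i exterior_angle v i = 2 * pi.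
Proof.
by apply: (@convex_polygon_ind n v (fun n v => \sum_i exterior_angle v i =
  2 * pi)) => m {}v cv; apply: sum_exterior_angle.
Qed.

Definition tan_sum n (v : 'I_n -> R * R) := \sum_i vertex_tan v i.

Lemma convex_lhuilier n (v : 'I_n -> R * R) : convex_polygon v ->
  4 * tan_sum v * shoelace v <= (\sum_i side_length v i) ^+ 2 /\
  (4 * tan_sum v * shoelace v = (\sum_i side_length v i) ^+ 2 ->
   exists k, forall i, side_length v i = k * (vertex_tan v i +
     vertex_tan v (ordS i))).
Proof.
apply: (@convex_polygon_ind n v (fun n v => 4 * tan_sum v * shoelace v <=
  (\sum_i side_length v i) ^+ 2 /\
  (4 * tan_sum v * shoelace v = (\sum_i side_length v i) ^+ 2 ->
   exists k, forall i, side_length v i = k * (vertex_tan v i +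
     vertex_tan v (ordS i))))).
by move=> m {}v cv; apply: lhuilier.
Qed.

Lemma tan_sum_gt0 n (v : 'I_n -> R * R) : convex_polygon v -> 0 < tan_sum v.
Proof.
move=> cv; pose i0 : 'I_n := Ordinal (ltn_trans (isT : 0 < 2)%N (proj1 cv)).
rewrite /tan_sum (bigD1 i0) //= ltr_pwDl ?vertex_tan_gt0 // sumr_ge0 // => i _.
by rewrite ltW // vertex_tan_gt0.
Qed.

Lemma unit_shoelace_le n (v : 'I_n -> R * R) : unit_convex_polygon v ->
  4 * tan_sum v * shoelace v <= 1.
Proof.
by case=> cv Lv; have [+ _] := convex_lhuilier cv; rewrite [\sum_i _]Lv expr1n.
Qed.

Lemma unit_circumscriptible n (v : 'I_n -> R * R) : unit_convex_polygon v ->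
  4 * tan_sum v * shoelace v = 1 <-> circumscriptible v.
Proof.
move=> [cv Lv]; split=> [E|/(circumscriptible_inscribed cv) [c [r [r0 cr]]]].
  have [_] := convex_lhuilier cv; rewrite [\sum_i _]Lv expr1n => /(_ E) [k].
  move=> /(length_inscribed cv) [k0 [c ck]].
  exact: (inscribed_circumscriptible cv ck).
rewrite (inscribed_shoelace cv cr) [\sum_i _]Lv.
have := inscribed_sum_length cv cr; rewrite [\sum_i _]Lv -/(tan_sum v) => E.
by rewrite [RHS]E; field.
Qed.

(** A larger interior angle is a smaller exterior one; b = a is the equiangular case. *)
Definition balanced n (v : 'I_n -> R * R) a b := b <= a /\
  exists2 i0, exterior_angle v i0 = b & forall i, i != i0 ->
    exterior_angle v i = a.

Lemma equal_angles_balanced n (v : 'I_n -> R * R) : convex_polygon v ->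
  equal_angles_but_one_larger v <-> exists a b, balanced v a b.
Proof.
move=> cv; pose i0 : 'I_n := Ordinal (ltn_trans (isT : 0 < 2)%N (proj1 cv)).
have E i : interior_angle v i = pi -
  exterior_angle v i by rewrite /exterior_angle subKr.
split=> [[t [H|[i1 [lt H]]]]|[a [b [ba [i1 H1 H]]]]].
- by exists (pi - t), (pi - t); split=> //; exists i0 => [|i _];
  rewrite /exterior_angle H.
- exists (pi - t), (pi - interior_angle v i1); split;
  first by rewrite lerD2l lerN2 ltW.
  by exists i1 => // i ii; rewrite /exterior_angle H.
- exists (pi - a); move: ba; rewrite le_eqVlt => /orP[/eqP ba|ba].
    left=> i; rewrite E; have [->|/H -> //] := eqVneq i i1.
    by rewrite H1 ba.
  right; exists i1; split; first by rewrite E H1 ltrD2l ltrN2.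
  by move=> i /H; rewrite E => ->.
Qed.

Lemma balanced_sum n (v : 'I_n.+1 -> R * R) a b (F : R -> R) : balanced v a b ->
  \sum_i F (exterior_angle v i) = F a *+ n + F b.
Proof.
move=> [_ [i0 <- H]]; rewrite (bigD1 i0) //= addrC; congr (_ + _).
rewrite (eq_bigr (fun=> F a)) => [|i /H -> //].
by rewrite sumr_const cardC1 card_ord.
Qed.

Lemma balanced_itv n (v : 'I_n.+1 -> R * R) a b : convex_polygon v ->
  balanced v a b -> 0 < b <= a /\ a < pi.
Proof.
move=> cv [ba [i0 H1 H]]; split.
  by rewrite ba andbT -H1; case/andP: (exterior_angle_itv cv i0).
have n1 : (1 < n.+1)%N := ltn_trans (isT : 1 < 2)%N (proj1 cv).
by rewrite -(H (ordS i0)) ?ordS_neq //;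
  case/andP: (exterior_angle_itv cv (ordS i0)).
Qed.

Let angles n (v : 'I_n -> R * R) := [seq exterior_angle v i | i <- enum 'I_n].

Lemma sum_angles n (v : 'I_n -> R * R) (F : R -> R) :
  \sum_(x <- angles v) F x = \sum_i F (exterior_angle v i).
Proof. by rewrite big_map big_enum. Qed.

Lemma perm_eq_balanced n (v : 'I_n -> R * R) k a b : b <= a ->
  perm_eq (angles v) (b :: nseq k a) -> balanced v a b.
Proof.
move=> ba E; split=> //.
have : b \in angles v by rewrite (perm_mem E) mem_head.
move=> /mapP[i0 _ bE]; exists i0 => // i ii.
have P : perm_eq (enum 'I_n) (i0 :: rem i0 (enum 'I_n)).
  by apply: perm_to_rem; rewrite mem_enum.
have := perm_map (exterior_angle v) P; rewrite perm_sym => /perm_trans /(_ E).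
rewrite /= -bE perm_cons => /perm_mem /(_ (exterior_angle v i)).
rewrite map_f ?mem_rem_uniq ?enum_uniq //; last by rewrite !inE ii mem_enum.
by move=> /esym; rewrite mem_nseq => /andP[_ /eqP].
Qed.

Lemma balanced_optimal n m (P : 'I_n.+1 -> R * R) (Q : 'I_m -> R * R) a b :
  convex_polygon P -> convex_polygon Q -> balanced P a b ->
  angle_functional Q = angle_functional P ->
  [/\ balanced Q a b, m = n.+1 & tan_sum P = tan_sum Q] \/ tan_sum P <
    tan_sum Q.
Proof.
move=> cP cQ Pab S; have [ba ap] := balanced_itv cP Pab.
have := @balanced_angles_minimize R (angles Q) n a b _ ba ap.
rewrite !sum_angles -(balanced_sum id Pab) -(balanced_sum (@angle_cost R) Pab).
rewrite -(balanced_sum (@tan_half R) Pab) -!angle_functionalE S /=.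
rewrite !convex_sum_exterior //.
case=> // [x /mapP[i _ ->]|E|]; [exact: exterior_angle_itv| |by right].
left; split; first exact: perm_eq_balanced Pab.1 E.
  by have := perm_size E; rewrite size_map size_enum_ord /= size_nseq.
rewrite /tan_sum (balanced_sum (@tan_half R) Pab) -sum_angles (perm_big _ E) /=.
by rewrite big_cons sum_nseq addrC.
Qed.

(** The angles determine T, and the unit perimeter 2 r T then determines the radius r. *)
Lemma balanced_congruent n (P Q : 'I_n -> R * R) a b :
  unit_convex_polygon P -> unit_convex_polygon Q ->
  circumscriptible P -> circumscriptible Q ->
  balanced P a b -> balanced Q a b -> congruent P Q.
Proof.
case: n P Q => [|n] P Q [cP LP] [cQ LQ]; first by case: cP.
move=> /(circumscriptible_inscribed cP) [c [r [r0 cr]]].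
move=> /(circumscriptible_inscribed cQ) [c' [r' [r0' cr']]] Pab Qab.
have T : tan_sum P = tan_sum Q.
  by rewrite /tan_sum (balanced_sum (@tan_half R) Pab) (balanced_sum (@tan_half
    R) Qab).
have rr : r' = r.
  have := inscribed_sum_length cP cr; have := inscribed_sum_length cQ cr'.
  rewrite [X in X = _ -> _]LQ [X in _ -> X = _ -> _]LP.
  rewrite -/(tan_sum P) -/(tan_sum Q) -T => E1 E2.
  have T0 : 2 * tan_sum P != 0 by rewrite mulf_neq0 // gt_eqF // tan_sum_gt0.
  apply: (mulIf T0); transitivity (1 : R); [rewrite [RHS]E1|rewrite [LHS]E2];
    ring.
rewrite rr in cr'.
case: Pab => _ [i0 Pi0 Pi]; case: Qab => _ [j0 Qj0 Qj].
apply: (inscribed_congruent cP cQ cr cr' (i0 := i0) (j0 := j0)) => k.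
case: (eqVneq (iter k (@ordS _) j0) j0) => [/[dup] E ->|E].
  have /eqP -> : iter k (@ordS _) i0 == i0 by rewrite (iter_ordS_eq k i0 j0) E.
  by rewrite Pi0.
by rewrite Qj // Pi // (iter_ordS_eq k i0 j0).
Qed.

Lemma angle_functional_gt n (v : 'I_n -> R * R) : convex_polygon v ->
  4 * pi < angle_functional v.
Proof.
move=> cv; have i0 : 'I_n := Ordinal (ltn_trans (isT : 0 < 2)%N (proj1 cv)).
rewrite angle_functionalE (_ : 4 * pi = \sum_i 2 * exterior_angle v i).
  apply: ltr_sum => [|i _]; last exact/angle_cost_gt/exterior_angle_itv.
  by apply/hasP; exists i0 => //; rewrite mem_index_enum.
by rewrite -mulr_sumr convex_sum_exterior // mulrA -natrM.
Qed.

Lemma balanced_exists S : 4 * pi < S ->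
  exists k (P : 'I_k.+1 -> R * R) a b, [/\ unit_convex_polygon P,
    circumscriptible P, balanced P a b & angle_functional P = S].
Proof.
move=> /(@balanced_angles_exist R) [k [a [b [k1 ba ap kab kS]]]].
have /andP[b0 ba'] := ba; have a0 : 0 < a := lt_le_trans b0 ba'.
pose T := tan_half a *+ k + tan_half b.
have T0 : 0 < T.
  rewrite ltr_wpDl ?tan_half_gt0 ?b0 ?(le_lt_trans ba') //.
  by rewrite mulrn_wge0 // ltW // tan_half_gt0 // a0.
(* The perimeter is 2 r T, to be made 1. *)
pose r := (2 * T)^-1; have r0 : 0 < r by rewrite invr_gt0 mulr_gt0.
pose P := @balanced_vertex R k a b r.
have cP : convex_polygon P by apply: balanced_convex.
have cr : inscribed P (0, 0) r by apply: balanced_inscribed.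
have Pab : balanced P a b.
  split=> //; exists ord0 => [|i i0]; rewrite balanced_exterior ?eqxx //.
  by rewrite (negPf i0).
exists k, P, a, b; split=> //.
- split=> //; rewrite [LHS](inscribed_sum_length cP cr).
  rewrite -/(tan_sum P) [tan_sum P](balanced_sum (@tan_half R) Pab) -/T /r.
  by field; rewrite gt_eqF.
- exact: (inscribed_circumscriptible cP cr).
- by rewrite angle_functionalE (balanced_sum (@angle_cost R) Pab).
Qed.

End Balanced.

Theorem theorem2 (R : realType) :
  (forall (n : nat) (P : 'I_n -> R * R),
     unit_convex_polygon P ->
     (maximizer P <->
      circumscriptible P /\ equal_angles_but_one_larger P)) /\
  (forall (n m : nat) (P : 'I_n -> R * R) (Q : 'I_m -> R * R),
     unit_convex_polygon P -> unit_convex_polygon Q ->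
     circumscriptible P -> equal_angles_but_one_larger P ->
     circumscriptible Q -> equal_angles_but_one_larger Q ->
     ~ congruent P Q ->
     angle_functional P <> angle_functional Q).
Proof.
split=> [n P uP|n m P Q uP uQ circP eqP circQ eqQ ncong S].
  have [cP LP] := uP; split=> [[_ maxP]|[circP eqP]].
    have [k [P' [a [b [uP' circP' Pab S]]]]] := balanced_exists
      (angle_functional_gt cP).
    have cP' := uP'.1.
    have := maxP _ _ uP' S; rewrite !area_shoelace // lee_fin => le_area.
    have T0 := tan_sum_gt0 cP; have T0' := tan_sum_gt0 cP'.
    have E' : 4 * tan_sum P' * shoelace P' =
      1 by apply/(unit_circumscriptible uP').
    have le1 := unit_shoelace_le uP.
    have A0 : 0 < shoelace P'.
      by rewrite -(pmulr_rgt0 _ (mulr_gt0 (ltr0n R 4) T0')) E'.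
    have le_mul (T : R) : 0 < T -> 4 * T * shoelace P' <= 4 * T * shoelace P.
      by move=> T1; rewrite ler_pM2l // mulr_gt0.
    (* If T were larger for P than for the competitor P', then 1 = 4 T' A' < 4 T A' <= 4 T A <= 1.
       Otherwise P is balanced with T = T', and 4 T A >= 4 T' A' = 1 is the equality case of
       Lhuilier's inequality. *)
    have [[bP _ TE]|lt] := balanced_optimal cP' cP Pab (esym S); last first.
      suff : 1 < 1 :> R by rewrite ltxx.
      apply: lt_le_trans le1; apply: lt_le_trans (le_mul _ T0).
      by rewrite -[X in X < _]E' ltr_pM2r // ltr_pM2l.
    split; last by apply/equal_angles_balanced => //; exists a, b.
    apply/unit_circumscriptible => //; apply/eqP;
      rewrite eq_le le1 /= -[X in X <= _]E'.
    by rewrite TE le_mul.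
  split=> // m Q uQ S; have [cQ LQ] := uQ.
  rewrite !area_shoelace // lee_fin.
  have E : 4 * tan_sum P * shoelace P = 1 by apply/(unit_circumscriptible uP).
  have le1 := unit_shoelace_le uQ; rewrite -[X in _ <= X]E in le1.
  have T0 := tan_sum_gt0 cP; have T0' := tan_sum_gt0 cQ.
  have [a [b Pab]] := (equal_angles_balanced cP).1 eqP.
  have le_T : tan_sum P <= tan_sum Q.
    move: P a b S Pab cP {uP LP circP eqP E le1 T0};
      case: n => [|n] P a b S Pab cP.
      by case: cP.
    by have [[_ _ ->]|/ltW] := balanced_optimal cP cQ Pab S.
  have A0 : 0 < shoelace P by rewrite -(pmulr_rgt0 _ (mulr_gt0 (ltr0n R 4) T0))
    E.
  have T4 : 0 < 4 * tan_sum Q by rewrite mulr_gt0.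
  (* With T and A for P, and T' and A' for Q: 4 T' A' <= 1 = 4 T A <= 4 T' A. *)
  rewrite -(ler_pM2l T4); apply: (le_trans le1).
  by rewrite ler_pM2r // ler_pM2l.
have [[cP _] [cQ _]] := (uP, uQ).
have [a [b Pab]] := (equal_angles_balanced cP).1 eqP.
have [a' [b' Qab]] := (equal_angles_balanced cQ).1 eqQ.
case: n P uP cP circP eqP ncong S Pab => [|n] P uP cP circP _ ncong S Pab;
  first by case: cP.
case: m Q uQ cQ circQ eqQ ncong S Qab => [|m] Q uQ cQ circQ _ ncong S Qab;
  first by case: cQ.
(* Each polygon is optimal against the other. Equality in either comparison yields a congruence, and
   the two strict inequalities between the values of T exclude each other. *)
have [[Qab2 E _]|lt] := balanced_optimal cP cQ Pab (esym S).
  case: E => E; subst m; apply: ncong;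
    exact: (balanced_congruent uP uQ circP circQ Pab Qab2).
have [[Pab2 E _]|lt'] := balanced_optimal cQ cP Qab S.
  case: E => E; subst m; apply: ncong;
    exact: (balanced_congruent uP uQ circP circQ Pab2 Qab).
by have := lt_trans lt lt'; rewrite ltxx.
Qed.
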